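(* Fix $F>0$, $E\in\mathbb{R}$, $\alpha\ge0$, $\beta>0$, $\sigma\in[1/2,1]$, $C>0$, and let $h:\mathbb{N}\to\mathbb{R}$ satisfy $|h(n+1)-h(n)|\le Cn^{-\beta}$ for all integers $n\in[X_l,X_{l+1}]$. Then for all sufficiently large $l$ and all $a<b$ with $X_l+Cl^\sigma\le a<b\le X_{l+1}-Cl^\sigma$, $$\Bigl|\sum_{a<n\le b}\frac{e^{i(2\gamma(n)+h(n))}}{\gamma'(n)^\alpha}\Bigr|\lesssim l^{-\alpha-\sigma+1}\bigl(1+l^{1-2\beta}\bigr),$$ with implicit constant uniform for $E,F,\alpha,\beta,\sigma,C$ in compact subsets of their domains.
   Context: The reference solution is $\zeta(x)=(\pi/F^{1/3})^{1/2}\bigl(i\,\mathrm{Ai}(-F^{1/3}(x+E/F))+\mathrm{Bi}(-F^{1/3}(x+E/F))\bigr)$ (Airy functions); it has no real zeros and $\gamma\in C^\infty(\mathbb{R})$ is the real function with $\zeta=|\zeta|e^{i\gamma}$, $\gamma(0)\in(-\pi,\pi]$. For $l$ large, $X_l$ denotes the unique (large) solution of $\gamma'(X_l)=\pi l$; sums are over integers $n$. *)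

(* Defs.v *)
From Stdlib Require Import Reals List.
From Coquelicot Require Import Coquelicot.
Open Scope R_scope.

(* Airy functions via their standard integral representations (DLMF 9.5.1, 9.5.5),
   as improper integrals over [0, +oo) (limits of RInt 0 b as b -> +oo). *)
Definition Ai (x : R) : R :=
  / PI * real (Lim (fun b => RInt (fun t => cos (t ^ 3 / 3 + x * t)) 0 b) p_infty).

Definition Bi (x : R) : R :=
  / PI * real (Lim (fun b => RInt (fun t => exp (- t ^ 3 / 3 + x * t)
                                          + sin (t ^ 3 / 3 + x * t)) 0 b) p_infty).

Definition zeta (F E : R) (x : R) : Complex.C :=
  let y := - (Rpower F (1/3)) * (x + E / F) in
  let c := sqrt (PI / Rpower F (1/3)) in
  (c * Bi y, c * Ai y).

(* gam is "the" phase of zeta: continuous real function with zeta = |zeta| e^{i gam},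
   gam(0) in (-pi, pi].  (Unique since zeta has no real zeros.) *)
Definition is_phase (F E : R) (gam : R -> R) : Prop :=
  (forall x, continuous gam x) /\
  (forall x, zeta F E x = (Cmod (zeta F E x) * cos (gam x),
                           Cmod (zeta F E x) * sin (gam x))) /\
  - PI < gam 0 <= PI.

(* X is the sequence of the (unique large) solutions of gam'(X_l) = pi l:
   eventually gam'(X l) = pi l, and X l -> +oo. *)
Definition is_X_seq (gam : R -> R) (X : nat -> R) : Prop :=
  (exists L : nat, forall l : nat, (L <= l)%nat -> Derive gam (X l) = PI * INR l) /\
  is_lim_seq X p_infty.

(* Sum of f n over natural numbers n with a < n <= b
   (all integers in (a,b] when a >= 0). *)
Definition sum_range (a b : R) (f : nat -> Complex.C) : Complex.C :=
  fold_right Cplus (RtoC 0)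
    (map f (filter (fun n => if Rlt_dec a (INR n) then
                               if Rle_dec (INR n) b then true else false
                             else false)
                   (seq 0 (Z.to_nat (up b))))).

Definition summand (gam : R -> R) (h : nat -> R) (alpha : R) (n : nat) : Complex.C :=
  let th := 2 * gam (INR n) + h n in
  let w := / Rpower (Derive gam (INR n)) alpha in
  (w * cos th, w * sin th).

(* Main.v *)
(** The function pi (Bi(-s) + i Ai(-s)) = Z(s) is an oscillatory integral plus an
    exponentially damped one.  Integrating by parts twice around the stationary point
    t = sqrt s gives Z' = (i sqrt s - 1/(4 s)) Z + O(s^-2), so that |Z|^2 does not oscillate:
    sqrt s |Z|^2 tends to the Wronskian W, and (|Z|^2)' = - |Z|^2 / (2 s) to leading order.
    Since gam' is F^(1/3) W / |Z|^2, this yields gam'' gam' >= F / 16 and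
    gam'^2 <= 8 F x for large x.  Hence gam' increases from pi l to pi (l+1) on [X_l, X_{l+1}],
    staying l^(sigma-1) away from the endpoints at distance l^sigma from X_l and X_{l+1},
    and the Kuzmin-Landau inequality bounds the sum of e^(2 i gam(n)) by l^(1-sigma).  The
    weight e^(i h(n)) / gam'(n)^alpha, whose total variation is at most
    l^(-alpha) (1 + l^(1-2 beta)) up to a constant, is absorbed by Abel summation. *)

Require Import Defs.
From Stdlib Require Import Reals PSeries_reg List Lra Lia.
From Coquelicot Require Import Coquelicot.
Open Scope R_scope.

(** * Oscillatory integrals and limits *)

(** Both Airy functions are limits of integrals that converge only conditionally, taken with the
    total operator [Lim]. So convergence, differentiability and the Airy equation have to be derived
    from the integrals themselves. For the oscillatory part all of it rests on [osc_bound], whose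
    bound by the initial amplitude does not involve the upper end of integration. Every limit
    carries a rate of order 1/b: this gives local uniformity in s, hence derivatives, and lets
    inequalities between truncated integrals pass to the limit.

    The shape of the later estimates is dictated by uniformity. The threshold in l may depend on F,
    E and the phase, the constant may not. The phase therefore enters the sum only through two
    inequalities from which W and E have disappeared. Their constants are coarse: gam'^2 is
    asymptotic to F x, and gam'' gam' tends to F / 2.

    The exponent 1 - 2 beta arises because a block consists of about l integers, each of order l^2,
    so that increments n^(-beta) of h add up to l^(1 - 2 beta). *)

Definition phase (s d t : R) : R := t ^ 3 / 3 - s * t + d.

Lemma is_derive_continuous (f : R -> R) (x l : R) : is_derive f x l -> continuous f x.
Proof. intros H. apply (ex_derive_continuous (V := R_NormedModule)). now exists l. Qed.

Lemma is_derive_phase (s d t : R) : is_derive (phase s d) t (t ^ 2 - s).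
Proof. unfold phase; auto_derive; trivial; field. Qed.

Lemma is_derive_sin_phase (s d t : R) :
  is_derive (fun t => sin (phase s d t)) t ((t ^ 2 - s) * cos (phase s d t)).
Proof.
  apply (is_derive_comp (K := R_AbsRing) (V := R_NormedModule) sin (phase s d)).
  apply is_derive_sin. apply is_derive_phase.
Qed.

Lemma is_derive_cos_phase (s d t : R) :
  is_derive (fun t => cos (phase s d t)) t ((t ^ 2 - s) * - sin (phase s d t)).
Proof.
  apply (is_derive_comp (K := R_AbsRing) (V := R_NormedModule) cos (phase s d)).
  apply is_derive_cos. apply is_derive_phase.
Qed.

(** The factor [(t ^ 2 - s) * cos] is the derivative of [sin (phase s d t)]. One integration by
    parts leaves boundary values of size at most [g a + g b] and the integral of [g' sin], at most
    [g a - g b] because [g'] has constant sign. The two [g b] cancel, and the interval may contain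
    the stationary point. *)
Lemma osc_bound (s d a b : R) (g g' : R -> R) :
  a <= b ->
  (forall t, a <= t <= b -> is_derive g t (g' t)) ->
  (forall t, a <= t <= b -> continuous g' t) ->
  (forall t, a <= t <= b -> g' t <= 0) ->
  0 <= g b ->
  Rabs (RInt (fun t => g t * (t ^ 2 - s) * cos (phase s d t)) a b) <= 2 * g a.
Proof.
  intros ab Dg Cg' Ng' gb.
  assert (E : forall t, Rmin a b <= t <= Rmax a b -> a <= t <= b).
  { intros t; rewrite Rmin_left, Rmax_right by lra; auto. }
  assert (Cs : forall t, continuous (fun t => sin (phase s d t)) t).
  { intros t; apply (is_derive_continuous _ _ _ (is_derive_sin_phase s d t)). }
  assert (Cc : forall t, continuous (fun t => (t ^ 2 - s) * cos (phase s d t)) t).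
  { intros t; apply (ex_derive_continuous (V := R_NormedModule)); unfold phase; auto_derive; trivial. }
  assert (I0 : is_RInt g' a b (g b - g a)).
  { apply (is_RInt_derive g g'); intros t Ht; auto. }
  assert (I1 : is_RInt (fun t => g' t * sin (phase s d t) +
                   g t * ((t ^ 2 - s) * cos (phase s d t))) a b
              (g b * sin (phase s d b) - g a * sin (phase s d a))).
  { apply (is_RInt_derive (fun t => g t * sin (phase s d t))).
    - intros t Ht.
      assert (Dt := Dg t (E t Ht)).
      generalize (is_derive_mult g (fun t => sin (phase s d t)) t _ _ Dt
                    (is_derive_sin_phase s d t) Rmult_comm).
      intros K; exact K.
    - intros t Ht. apply (continuous_plus (V := R_NormedModule)).
      + apply (continuous_mult (K := R_AbsRing)); auto.
      + apply (continuous_mult (K := R_AbsRing)); auto. apply is_derive_continuous with (g' t); auto. }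
  assert (X2 : ex_RInt (fun t => g' t * sin (phase s d t)) a b).
  { apply (@ex_RInt_continuous R_CompleteNormedModule). intros t Ht.
    apply (continuous_mult (K := R_AbsRing)); auto. }
  pose proof (RInt_correct _ _ _ X2) as I2.
  set (S := RInt _ a b) in I2.
  assert (BS : Rabs S <= g a - g b).
  { apply Rabs_le. split.
    - apply Rle_trans with (RInt g' a b); [ rewrite (is_RInt_unique _ _ _ _ I0); lra | ].
      apply RInt_le; auto. eexists; eauto.
      intros t Ht. generalize (SIN_bound (phase s d t)) (Ng' t ltac:(lra)). nra.
    - apply Rle_trans with (RInt (fun t => opp (g' t)) a b).
      + apply RInt_le; auto. apply (ex_RInt_opp (V := R_NormedModule)). eexists; eauto.
        intros t Ht. generalize (SIN_bound (phase s d t)) (Ng' t ltac:(lra)).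
        unfold opp; simpl. nra.
      + apply Req_le. etransitivity.
        exact (is_RInt_unique _ _ _ _ (is_RInt_opp _ _ _ _ I0)).
        unfold opp; simpl; lra. }
  generalize (is_RInt_minus _ _ _ _ _ _ I1 I2). intros I3.
  rewrite (RInt_ext _ (fun t => minus (g' t * sin (phase s d t) +
                   g t * ((t ^ 2 - s) * cos (phase s d t))) (g' t * sin (phase s d t)))).
  2: { intros t Ht. unfold minus, plus, opp; simpl. ring. }
  match goal with |- Rabs ?x <= _ => replace x with
    ((g b * sin (phase s d b) - g a * sin (phase s d a)) - S) end.
  2: { symmetry. exact (is_RInt_unique _ _ _ _ I3). }
  assert (g b <= g a) by (generalize (Rabs_pos S); lra).
  generalize (SIN_bound (phase s d b)) (SIN_bound (phase s d a)). intros.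
  apply Rabs_le_between in BS. apply Rabs_le. nra.
Qed.

(** [real (Lim ...)] is meaningful only once the limit is known to be finite, which the Cauchy
    criterion supplies. The explicit rate is kept because it is uniform in a parameter as soon as
    [B] and [C] are. *)
Lemma lim_tail (I : R -> R) (B C : R) :
  0 < B ->
  (forall b b', B <= b <= b' -> Rabs (I b' - I b) <= C / b) ->
  is_lim I p_infty (real (Lim I p_infty)) /\
  forall b, B <= b -> Rabs (I b - real (Lim I p_infty)) <= C / b.
Proof.
  intros B0 H.
  assert (C0 : 0 <= C).
  { generalize (H B B ltac:(lra)) (Rabs_pos (I B - I B)); intros.
    apply Rmult_le_reg_r with (/ B). now apply Rinv_0_lt_compat. unfold Rdiv in *; lra. }
  assert (L : exists y, is_lim I p_infty (Finite y)).
  { apply (proj1 (filterlim_locally_cauchy (U := R_CompleteSpace)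
             (F := Rbar_locally' p_infty) I)). intros eps.
    exists (fun b => Rmax B (C / eps + 1) < b). split.
    - exists (Rmax B (C / eps + 1)). auto.
    - assert (K : forall u v, Rmax B (C / eps + 1) < u -> u <= v -> Rabs (I v - I u) < eps).
      { intros u v Hu uv.
        generalize (Rmax_l B (C / eps + 1)) (Rmax_r B (C / eps + 1)); intros.
        apply Rle_lt_trans with (C / u). apply H; lra.
        apply Rmult_lt_reg_r with u. lra. unfold Rdiv.
        rewrite Rmult_assoc, Rinv_l, Rmult_1_r by lra.
        assert (E : C / eps < u) by lra. generalize (cond_pos eps); intros.
        apply Rmult_lt_compat_r with (r := eps) in E; auto.
        unfold Rdiv in E. rewrite Rmult_assoc, Rinv_l in E by lra. lra. }
      intros u v Hu Hv. unfold ball; simpl; unfold AbsRing_ball, abs, minus, plus, opp; simpl.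
      destruct (Rle_dec u v).
      + apply (K u v); auto.
      + rewrite <- Rabs_Ropp. replace (- (I v + - I u)) with (I u - I v) by ring.
        apply K; auto; lra. }
  destruct L as [y Hy].
  rewrite (is_lim_unique _ _ _ Hy). simpl. split; auto.
  intros b Hb.
  apply (is_lim_le_loc (fun b' => Rabs (I b - I b')) (fun _ => C / b) p_infty
     (Finite (Rabs (I b - y))) (Finite (C / b))).
  - exists b. intros b' Hb'. rewrite Rabs_minus_sym. apply H; lra.
  - change (is_lim (fun b' => Rabs (I b - I b')) p_infty (Rbar_abs (Finite (I b - y)))).
    apply is_lim_Rabs.
    apply is_lim_minus with (Finite (I b)) (Finite y); auto. apply is_lim_const.
    reflexivity.
  - apply is_lim_const.
Qed.

Lemma inv_INR_small (C eps : R) : 0 < eps ->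
  exists N, forall n, (N <= n)%nat -> C / INR (S n) < eps.
Proof.
  intros He. destruct (nfloor_ex (Rabs (C / eps)) (Rabs_pos _)) as [N HN].
  exists N. intros n Hn. apply le_INR in Hn.
  assert (0 < INR (S n)) by apply (lt_0_INR _ (Nat.lt_0_succ n)).
  apply Rmult_lt_reg_r with (INR (S n)); auto. unfold Rdiv.
  rewrite Rmult_assoc, Rinv_l, Rmult_1_r by lra.
  assert (E : C / eps < INR (S n)).
  { rewrite S_INR in *. generalize (Rle_abs (C / eps)). lra. }
  apply Rmult_lt_compat_r with (r := eps) in E; auto.
  unfold Rdiv in E. rewrite Rmult_assoc, Rinv_l in E by lra. lra.
Qed.

(** Derivatives that converge uniformly near [s] pass to the limit; the limit is taken along
    [b = INR (S n)], which stays positive. The rates have the form that [lim_tail] delivers. *)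
Lemma derive_limit (fb fb' : R -> R -> R) (f g : R -> R) (s B C : R) :
  (forall b y, 0 < b -> Rabs (y - s) < 1 -> is_derive (fb b) y (fb' b y)) ->
  (forall b y, B <= b -> Rabs (y - s) < 1 -> Rabs (fb b y - f y) <= C / b) ->
  (forall b y, B <= b -> Rabs (y - s) < 1 -> Rabs (fb' b y - g y) <= C / b) ->
  is_derive f s (g s).
Proof.
  intros HD Hf Hg.
  assert (K : forall eps, 0 < eps -> exists N, forall n, (N <= n)%nat ->
            B <= INR (S n) /\ C / INR (S n) < eps).
  { intros eps He. destruct (inv_INR_small C eps He) as [N1 HN1].
    destruct (nfloor_ex (Rabs B) (Rabs_pos _)) as [N HN].
    exists (max N N1). intros n Hn. split. 2: apply HN1; lia.
    assert (Hn' : (N <= n)%nat) by lia. apply le_INR in Hn'. rewrite S_INR.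
    generalize (Rle_abs B). lra. }
  apply is_derive_Reals.
  apply (CVU_derivable (fun n => fb (INR (S n))) (fun n => fb' (INR (S n))) f g s
           (mkposreal 1 Rlt_0_1)).
  - intros eps He. destruct (K eps He) as [N HN].
    exists N. intros n y Hn Hy. destruct (HN n Hn). rewrite Rabs_minus_sym.
    eapply Rle_lt_trans. apply Hg; auto. auto.
  - intros y Hy eps He. destruct (K eps He) as [N HN].
    exists N. intros n Hn. destruct (HN n Hn). eapply Rle_lt_trans. apply Hf; auto. auto.
  - intros n y Hy. apply is_derive_Reals, HD; auto. apply (lt_0_INR _ (Nat.lt_0_succ n)).
  - unfold Boule; simpl. rewrite Rminus_diag. rewrite Rabs_R0. lra.
Qed.

(** * The integrals of cos and t sin with cubic phase *)

Ltac eqR := match goal with |- ?x = ?y => change (@eq R x y) end.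

Lemma RInt_ext_le (f g : R -> R) (a b : R) :
  a <= b -> (forall t, a <= t <= b -> f t = g t) -> RInt f a b = RInt g a b.
Proof.
  intros ab H. apply RInt_ext. intros t. rewrite Rmin_left, Rmax_right by lra.
  intros Ht. apply H. lra.
Qed.

Lemma is_derive_RInt_right (f f2 : R -> R -> R) (b s : R) :
  (forall u t, is_derive (fun u => f u t) u (f2 u t)) ->
  (forall u t, continuity_2d_pt f2 u t) ->
  (forall u t, continuous (f u) t) ->
  is_derive (fun u => RInt (f u) 0 b) s (RInt (f2 s) 0 b).
Proof.
  intros HD HC Hc.
  rewrite (RInt_ext (f2 s) (fun t => Derive (fun u => f u t) s)).
  2: { intros t _. symmetry. apply is_derive_unique, HD. }
  apply is_derive_RInt_param.
  - apply filter_forall. intros u t _. eexists; apply HD.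
  - intros t _. apply continuity_2d_pt_ext with f2; auto.
    intros u v. symmetry. apply is_derive_unique, HD.
  - apply filter_forall. intros u. apply (ex_RInt_continuous (V := R_CompleteNormedModule)). auto.
Qed.

Lemma continuity_2d_phase (d u t : R) : continuity_2d_pt (fun u v => phase u d v) u t.
Proof.
  unfold phase. apply continuity_2d_pt_plus. apply continuity_2d_pt_minus.
  - apply (continuity_1d_2d_pt_comp (fun v => v ^ 3 / 3) (fun _ v => v)).
    reg. apply continuity_2d_pt_id2.
  - apply continuity_2d_pt_mult. apply continuity_2d_pt_id1. apply continuity_2d_pt_id2.
  - apply continuity_2d_pt_const.
Qed.

Lemma is_derive_phase_l (d t s : R) : is_derive (fun s => phase s d t) s (- t).
Proof. unfold phase; auto_derive; trivial; ring. Qed.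

Lemma is_derive_sin_phase_l (d t s : R) :
  is_derive (fun s => sin (phase s d t)) s (- t * cos (phase s d t)).
Proof.
  apply (is_derive_comp (K := R_AbsRing) (V := R_NormedModule) sin (fun s => phase s d t)).
  apply is_derive_sin. apply is_derive_phase_l.
Qed.

Lemma is_derive_cos_phase_l (d t s : R) :
  is_derive (fun s => cos (phase s d t)) s (t * sin (phase s d t)).
Proof.
  replace (t * sin (phase s d t)) with (- t * - sin (phase s d t)) by ring.
  apply (is_derive_comp (K := R_AbsRing) (V := R_NormedModule) cos (fun s => phase s d t)).
  apply is_derive_cos. apply is_derive_phase_l.
Qed.

Lemma sin_phase (s d t : R) : sin (phase s d t) = cos (phase s (d - PI / 2) t).
Proof.
  rewrite <- cos_shift. rewrite <- (cos_neg (PI / 2 - _)). f_equal. unfold phase; ring.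
Qed.

(* The shift [d] treats the cosine ([d = 0]) and the sine ([d = - PI / 2]) at once. *)
Definition cosint_trunc (d s b : R) : R := RInt (fun t => cos (phase s d t)) 0 b.
Definition tsinint_trunc (d s b : R) : R := RInt (fun t => t * sin (phase s d t)) 0 b.
Definition cosint (d s : R) : R := real (Lim (cosint_trunc d s) p_infty).
Definition tsinint (d s : R) : R := real (Lim (tsinint_trunc d s) p_infty).

Lemma continuous_cos_phase (s d t : R) : continuous (fun t => cos (phase s d t)) t.
Proof. exact (is_derive_continuous _ _ _ (is_derive_cos_phase s d t)). Qed.

Lemma continuous_sin_phase (s d t : R) : continuous (fun t => sin (phase s d t)) t.
Proof. exact (is_derive_continuous _ _ _ (is_derive_sin_phase s d t)). Qed.

Lemma continuous_mulR (f g : R -> R) (t : R) :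
  continuous f t -> continuous g t -> continuous (fun t => f t * g t) t.
Proof. apply (continuous_mult (K := R_AbsRing)). Qed.

Lemma continuous_pow (n : nat) (t : R) : continuous (fun t => t ^ n) t.
Proof. apply (ex_derive_continuous (V := R_NormedModule)). auto_derive; trivial. Qed.

Lemma RInt_tail (f : R -> R) (b b' : R) :
  (forall t, continuous f t) -> RInt f 0 b' - RInt f 0 b = RInt f b b'.
Proof.
  intros Hf.
  assert (X : forall u v, ex_RInt f u v)
    by (intros; apply (ex_RInt_continuous (V := R_CompleteNormedModule)); auto).
  rewrite <- (RInt_Chasles f 0 b b' (X _ _) (X _ _)). unfold plus; simpl. ring.
Qed.

(** From [2 * S + 2] on, [t ^ 2 - s] is at least half of [t ^ 2]: the stationary point lies behind,
    and [osc_bound] applies with amplitude [1 / (t ^ 2 - s)]. The threshold depends on [s] only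
    through [S], and [-1 <= s] leaves room for the unit ball of [derive_limit] around a nonnegative
    point. *)
Lemma cosint_trunc_tail (S s d b b' : R) : 1 <= S -> -1 <= s <= S -> 2 * S + 2 <= b <= b' ->
  Rabs (cosint_trunc d s b' - cosint_trunc d s b) <= 4 / b.
Proof.
  intros HS Hs Hb. unfold cosint_trunc. rewrite RInt_tail by (intros; apply continuous_cos_phase).
  assert (P : forall t, b <= t <= b' -> t ^ 2 / 2 <= t ^ 2 - s) by (intros; nra).
  rewrite (RInt_ext_le _ (fun t => (/ (t ^ 2 - s)) * (t ^ 2 - s) * cos (phase s d t))).
  2: lra.
  2: { intros t Ht.
       field. assert (t ^ 2 / 2 <= t ^ 2 - s) by (apply P; lra). nra. }
  eapply Rle_trans.
  - apply (osc_bound s d b b' _ (fun t => - (2 * t) / (t ^ 2 - s) ^ 2)).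
    + lra.
    + intros t Ht. generalize (P t Ht); intros. auto_derive. nra. field. nra.
    + intros t Ht. generalize (P t Ht); intros.
      apply (ex_derive_continuous (V := R_NormedModule)). auto_derive.
      apply Rgt_not_eq. assert (0 < t ^ 2 - s) by nra. nra.
    + intros t Ht. generalize (P t Ht); intros.
      assert (0 < (t ^ 2 - s) ^ 2) by (apply pow_lt; nra).
      unfold Rdiv. assert (0 < / (t ^ 2 - s) ^ 2) by now apply Rinv_0_lt_compat. nra.
    + apply Rlt_le, Rinv_0_lt_compat. generalize (P b' ltac:(lra)). nra.
  - generalize (P b ltac:(lra)); intros.
    assert (b / 2 <= b ^ 2 - s) by nra.
    assert (/ (b ^ 2 - s) <= / (b / 2)) by (apply Rinv_le_contravar; lra).
    replace (4 / b) with (2 * / (b / 2)) by (field; lra). lra.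
Qed.

(** The integrand grows, but the amplitude [t / (t ^ 2 - s)] still decreases to 0, so oscillation
    alone yields convergence at the same rate. *)
Lemma tsinint_trunc_tail (S s d b b' : R) : 1 <= S -> -1 <= s <= S -> 2 * S + 2 <= b <= b' ->
  Rabs (tsinint_trunc d s b' - tsinint_trunc d s b) <= 4 / b.
Proof.
  intros HS Hs Hb. unfold tsinint_trunc.
  rewrite RInt_tail by (intros; apply continuous_mulR;
    [ apply continuous_id | apply continuous_sin_phase ]).
  assert (P : forall t, b <= t <= b' -> t ^ 2 / 2 <= t ^ 2 - s) by (intros; nra).
  rewrite (RInt_ext_le _ (fun t => (t / (t ^ 2 - s)) * (t ^ 2 - s) * cos (phase s (d - PI / 2) t))).
  2: lra.
  2: { intros t Ht. rewrite sin_phase.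
       field. assert (t ^ 2 / 2 <= t ^ 2 - s) by (apply P; lra). nra. }
  eapply Rle_trans.
  - apply (osc_bound s _ b b' _ (fun t => - (t ^ 2 + s) / (t ^ 2 - s) ^ 2)).
    + lra.
    + intros t Ht. generalize (P t Ht); intros. auto_derive. nra. field. nra.
    + intros t Ht. generalize (P t Ht); intros.
      apply (ex_derive_continuous (V := R_NormedModule)). auto_derive.
      apply Rgt_not_eq. assert (0 < t ^ 2 - s) by nra. nra.
    + intros t Ht. generalize (P t Ht); intros.
      assert (0 < (t ^ 2 - s) ^ 2) by (apply pow_lt; nra).
      unfold Rdiv. assert (0 < / (t ^ 2 - s) ^ 2) by now apply Rinv_0_lt_compat.
      assert (0 <= t ^ 2 + s) by nra. nra.
    + apply Rlt_le, Rdiv_lt_0_compat. lra. generalize (P b' ltac:(lra)). nra.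
  - generalize (P b ltac:(lra)); intros.
    assert (/ (b ^ 2 - s) <= / (b ^ 2 / 2)) by (apply Rinv_le_contravar; nra).
    replace (4 / b) with (2 * (b * / (b ^ 2 / 2))) by (field; lra).
    unfold Rdiv. apply Rmult_le_compat_l. lra. apply Rmult_le_compat_l; lra.
Qed.

Lemma cosint_trunc_lim (S s d : R) : 1 <= S -> -1 <= s <= S ->
  is_lim (cosint_trunc d s) p_infty (cosint d s) /\
  forall b, 2 * S + 2 <= b -> Rabs (cosint_trunc d s b - cosint d s) <= 4 / b.
Proof.
  intros HS Hs. apply lim_tail. lra. intros; apply (cosint_trunc_tail S); auto.
Qed.

Lemma tsinint_trunc_lim (S s d : R) : 1 <= S -> -1 <= s <= S ->
  is_lim (tsinint_trunc d s) p_infty (tsinint d s) /\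
  forall b, 2 * S + 2 <= b -> Rabs (tsinint_trunc d s b - tsinint d s) <= 4 / b.
Proof.
  intros HS Hs. apply lim_tail. lra. intros; apply (tsinint_trunc_tail S); auto.
Qed.

Lemma is_derive_cosint_trunc (d b s : R) : is_derive (fun s => cosint_trunc d s b) s (tsinint_trunc d s b).
Proof.
  apply (is_derive_RInt_right (fun s t => cos (phase s d t)) (fun s t => t * sin (phase s d t))).
  - intros. apply is_derive_cos_phase_l.
  - intros. apply continuity_2d_pt_mult. apply continuity_2d_pt_id2.
    apply (continuity_1d_2d_pt_comp sin). apply continuity_sin. apply continuity_2d_phase.
  - intros. apply continuous_cos_phase.
Qed.

(** Writing [t ^ 2] as [(t ^ 2 - s) + s] makes one part an exact derivative. This is the Airy
    equation for truncated integrals; [sin d] comes from the endpoint 0 and survives in the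
    limit. *)
Lemma RInt_sqr_cos_phase (d b s : R) :
  RInt (fun t => t * (- t * cos (phase s d t))) 0 b =
  - s * cosint_trunc d s b - sin (phase s d b) + sin d.
Proof.
  assert (I1 : is_RInt (fun t => (t ^ 2 - s) * cos (phase s d t)) 0 b
     (sin (phase s d b) - sin (phase s d 0))).
  { apply (is_RInt_derive (fun t => sin (phase s d t))).
    - intros; apply is_derive_sin_phase.
    - intros; apply continuous_mulR. 2: apply continuous_cos_phase.
      apply (ex_derive_continuous (V := R_NormedModule)). auto_derive; trivial. }
  assert (I2 : is_RInt (fun t => cos (phase s d t)) 0 b (cosint_trunc d s b)).
  { apply (RInt_correct (V := R_CompleteNormedModule)).
    apply (ex_RInt_continuous (V := R_CompleteNormedModule)).
    intros; apply continuous_cos_phase. }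
  generalize (is_RInt_opp _ _ _ _ (is_RInt_plus _ _ _ _ _ _ I1 (is_RInt_scal _ _ _ s _ I2))).
  intros I3. rewrite (RInt_ext _ (fun t => opp (plus ((t ^ 2 - s) * cos (phase s d t))
     (scal s (cos (phase s d t)))))).
  2: { intros t _; unfold opp, plus, scal; simpl; unfold mult; simpl.
       eqR. ring. }
  etransitivity. exact (is_RInt_unique _ _ _ _ I3).
  unfold opp, plus, scal; simpl; unfold mult; simpl.
  replace (phase s d 0) with d by (unfold phase; field).
  eqR. ring.
Qed.

Lemma is_derive_tsinint_trunc (d b s : R) :
  is_derive (fun s => tsinint_trunc d s b) s (- s * cosint_trunc d s b - sin (phase s d b) + sin d).
Proof.
  rewrite <- RInt_sqr_cos_phase.
  apply (is_derive_RInt_right (fun s t => t * sin (phase s d t))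
     (fun s t => t * (- t * cos (phase s d t)))).
  - intros. apply is_derive_scal. apply is_derive_sin_phase_l.
  - intros. apply continuity_2d_pt_mult. apply continuity_2d_pt_id2.
    apply continuity_2d_pt_mult. apply continuity_2d_pt_opp, continuity_2d_pt_id2.
    apply (continuity_1d_2d_pt_comp cos). apply continuity_cos. apply continuity_2d_phase.
  - intros. apply continuous_mulR. apply continuous_id. apply continuous_sin_phase.
Qed.

Lemma is_derive_cosint (d s : R) : 0 <= s -> is_derive (cosint d) s (tsinint d s).
Proof.
  intros Hs.
  apply (derive_limit (fun b s => cosint_trunc d s b) (fun b s => tsinint_trunc d s b) (cosint d) (tsinint d) s
           (2 * (s + 1) + 2) 4).
  - intros; apply is_derive_cosint_trunc.
  - intros b y Hb Hy. apply Rabs_def2 in Hy. apply (cosint_trunc_lim (s + 1)); lra.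
  - intros b y Hb Hy. apply Rabs_def2 in Hy. apply (tsinint_trunc_lim (s + 1)); lra.
Qed.

(* The derivatives of [tsinint_trunc] oscillate without converging; adding
   [cos (phase y d b) / b], which tends to 0, cancels the oscillation. *)
Lemma is_derive_tsinint (d s : R) : 0 <= s -> is_derive (tsinint d) s (- s * cosint d s + sin d).
Proof.
  intros Hs.
  (* One constant serves both rates: 4 + 1 for the functions, the 1 being due to the corrector, and
     [4 * (s + 1)] for the derivatives, where the truncation error is multiplied by [y]. *)
  apply (derive_limit (fun b s => tsinint_trunc d s b + cos (phase s d b) / b)
      (fun b s => - s * cosint_trunc d s b + sin d) (tsinint d) (fun s => - s * cosint d s + sin d) s
           (2 * (s + 1) + 2) (5 + 4 * (s + 1))).
  - intros b y Hb _.
    replace (- y * cosint_trunc d y b + sin d) with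
      ((- y * cosint_trunc d y b - sin (phase y d b) + sin d) + / b * (b * sin (phase y d b)))
      by (field; lra).
    apply (is_derive_plus (fun s => tsinint_trunc d s b)). apply is_derive_tsinint_trunc.
    apply (is_derive_ext (fun s => / b * cos (phase s d b))).
    intros; unfold Rdiv; apply Rmult_comm.
    apply is_derive_scal. apply is_derive_cos_phase_l.
  - intros b y Hb Hy. apply Rabs_def2 in Hy.
    destruct (tsinint_trunc_lim (s + 1) y d) as [_ H]; try lra. specialize (H b Hb).
    replace (tsinint_trunc d y b + cos (phase y d b) / b - tsinint d y) with
      ((tsinint_trunc d y b - tsinint d y) + cos (phase y d b) / b) by ring.
    eapply Rle_trans. apply Rabs_triang.
    assert (ib : 0 < / b) by (apply Rinv_0_lt_compat; lra).
    assert (Rabs (cos (phase y d b) / b) <= / b).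
    { unfold Rdiv. rewrite Rabs_mult, (Rabs_pos_eq (/ b)) by lra.
      assert (Rabs (cos (phase y d b)) <= 1) by (apply Rabs_le, COS_bound). nra. }
    unfold Rdiv in *. nra.
  - intros b y Hb Hy. apply Rabs_def2 in Hy.
    destruct (cosint_trunc_lim (s + 1) y d) as [_ H]; try lra. specialize (H b Hb).
    replace (- y * cosint_trunc d y b + sin d - (- y * cosint d y + sin d)) with
      (- y * (cosint_trunc d y b - cosint d y)) by ring.
    rewrite Rabs_mult.
    assert (ib : 0 < / b) by (apply Rinv_0_lt_compat; lra).
    assert (Rabs (- y) <= s + 1) by (apply Rabs_le; lra).
    generalize (Rabs_pos (-y)) (Rabs_pos (cosint_trunc d y b - cosint d y)). unfold Rdiv in *.
    intros. apply Rle_trans with ((s + 1) * (4 * / b)).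
    apply Rmult_le_compat; auto. nra.
Qed.

(** * Cancellation at the stationary point *)

(** This carries estimates on truncated integrals, with errors of order 1/b, over to their
    limits. *)
Lemma le_of_le_plus_inv (x a B C : R) :
  (forall b, B <= b -> x <= a + C / b) -> x <= a.
Proof.
  intros H. apply Rnot_lt_le. intros Hx.
  set (b := Rmax (Rmax B 1) ((Rabs C + 1) / (x - a))).
  assert (B <= b) by (unfold b; eapply Rle_trans; [apply Rmax_l|apply Rmax_l]).
  assert (1 <= b) by (unfold b; eapply Rle_trans; [apply Rmax_r|apply Rmax_l]).
  assert ((Rabs C + 1) / (x - a) <= b) by apply Rmax_r.
  assert (Rabs C + 1 <= b * (x - a)).
  { apply Rmult_le_compat_r with (r := x - a) in H2. 2: lra.
    replace ((Rabs C + 1) / (x - a) * (x - a)) with (Rabs C + 1) in H2 by (field; lra). lra. }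
  generalize (H b H0) (Rle_abs C); intros.
  assert (C / b * b = C) by (field; lra). nra.
Qed.

Lemma RInt_le_continuous (f g : R -> R) (a b : R) : a <= b ->
  (forall t, continuous f t) -> (forall t, continuous g t) ->
  (forall t, a < t < b -> f t <= g t) -> RInt f a b <= RInt g a b.
Proof.
  intros ab Hf Hg H. apply RInt_le; auto;
  apply (ex_RInt_continuous (V := R_CompleteNormedModule)); auto.
Qed.

Lemma RInt_ge_0_continuous (f : R -> R) (a b : R) : a <= b ->
  (forall t, continuous f t) -> (forall t, a < t < b -> 0 <= f t) -> 0 <= RInt f a b.
Proof.
  intros ab Hf H. apply RInt_ge_0; auto.
  apply (ex_RInt_continuous (V := R_CompleteNormedModule)); auto.
Qed.

Lemma is_RInt_continuous (f : R -> R) (a b : R) :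
  (forall t, continuous f t) -> is_RInt f a b (RInt f a b).
Proof.
  intros H. apply (RInt_correct (V := R_CompleteNormedModule)).
  apply (ex_RInt_continuous (V := R_CompleteNormedModule)). auto.
Qed.

(* [(t - q) sin + cos / (4 s)] is the derivative of [- cos / (t + q)] plus
   [(t ^ 2 - s) cos] times the decreasing amplitude [(3 q + t) / (4 s (t + q) ^ 3)]:
   the stationary point [t = q] has been cancelled twice. *)
Lemma osc_asymptotics (s d : R) : 1 <= s ->
  Rabs (tsinint d s - sqrt s * cosint (d - PI / 2) s + cosint d s / (4 * s) - cos d / sqrt s)
    <= 3 / (2 * s ^ 2).
Proof.
  intros Hs. set (q := sqrt s).
  assert (q0 : 0 < q) by (apply sqrt_lt_R0; lra).
  assert (qq : q * q = s) by (apply sqrt_sqrt; lra).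
  assert (F : forall b, 0 < b -> Rabs (tsinint_trunc d s b - q * cosint_trunc (d - PI / 2) s b + cosint_trunc d s b / (4 * s)
      - cos d / q) <= 3 / (2 * s ^ 2) + 1 / b).
  { intros b Hb.
    set (g := fun t => (3 * q + t) / (t + q) ^ 3).
    assert (Dg : forall t, 0 <= t <= b -> is_derive g t (- (2 * t + 8 * q) / (t + q) ^ 4)).
    { intros t Ht. unfold g. auto_derive.
      apply Rgt_not_eq. apply (pow_lt (t + q) 3). lra. simpl. field. lra. }
    assert (Cg : forall t, 0 <= t <= b -> continuous (fun t => - (2 * t + 8 * q) / (t + q) ^ 4) t).
    { intros t Ht. apply (ex_derive_continuous (V := R_NormedModule)). auto_derive.
      apply Rgt_not_eq. apply (pow_lt (t + q) 4). lra. }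
    assert (BG := osc_bound s d 0 b g _ (Rlt_le _ _ Hb) Dg Cg).
    assert (X : Rabs (RInt (fun t => g t * (t ^ 2 - s) * cos (phase s d t)) 0 b) <= 2 * g 0).
    { apply BG.
      - intros t Ht. unfold Rdiv. assert (0 < / (t + q) ^ 4).
        apply Rinv_0_lt_compat, pow_lt; lra. nra.
      - unfold g. apply Rlt_le, Rdiv_lt_0_compat. lra. apply pow_lt; lra. }
    clear BG.
    assert (CX : forall t, 0 <= t <= b ->
       continuous (fun t => g t * (t ^ 2 - s) * cos (phase s d t)) t).
    { intros t Ht. apply continuous_mulR. apply continuous_mulR.
      - exact (is_derive_continuous _ _ _ (Dg t Ht)).
      - apply (ex_derive_continuous (V := R_NormedModule)). auto_derive; trivial.
      - apply continuous_cos_phase. }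
    (* At [t = q] the coefficient [1 / (t + q) ^ 2] equals [1 / (4 * s)], so their difference
       vanishes at the stationary point and is a multiple of [t ^ 2 - s]. This is the origin of the
       term [cosint d s / (4 * s)]; the endpoint [t = 0] produces [cos d / q]. *)
    set (h' := fun t => (t - q) * sin (phase s d t) + cos (phase s d t) / (t + q) ^ 2).
    assert (Ih : is_RInt h' 0 b (- cos (phase s d b) / (b + q) - - cos (phase s d 0) / (0 + q))).
    { apply (is_RInt_derive (fun t => - cos (phase s d t) / (t + q))).
      - intros t. rewrite Rmin_left, Rmax_right by lra. intros Ht.
        assert (Di : is_derive (fun t => / (t + q)) t (- 1 / (t + q) ^ 2)).
        { auto_derive. lra. field. lra. }
        generalize (is_derive_opp _ _ _ (is_derive_mult _ _ _ _ _
            (is_derive_cos_phase s d t) Di Rmult_comm)). intros M.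
        replace (h' t) with (opp (plus (mult ((t ^ 2 - s) * - sin (phase s d t)) (/ (t + q)))
           (mult (cos (phase s d t)) (-1 / (t + q) ^ 2)))).
        apply (is_derive_ext (fun t => opp (mult (cos (phase s d t)) (/ (t + q)))) _ t); trivial.
        { intros u. unfold opp, mult; simpl. eqR. unfold Rdiv. ring. }
        unfold opp, plus, mult, h'; simpl. eqR. rewrite <- qq. field. lra.
      - intros t. rewrite Rmin_left, Rmax_right by lra. intros Ht. unfold h'.
        apply (continuous_plus (V := R_NormedModule)).
        + apply continuous_mulR. 2: apply continuous_sin_phase.
          apply (ex_derive_continuous (V := R_NormedModule)). auto_derive; trivial.
        + apply continuous_mulR. apply continuous_cos_phase.
          apply (ex_derive_continuous (V := R_NormedModule)). auto_derive.
          apply Rgt_not_eq. apply (pow_lt (t + q) 2). lra. }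
    assert (Ig : is_RInt (fun t => g t * (t ^ 2 - s) * cos (phase s d t)) 0 b
       (RInt (fun t => g t * (t ^ 2 - s) * cos (phase s d t)) 0 b)).
    { apply (RInt_correct (V := R_CompleteNormedModule)).
      apply (ex_RInt_continuous (V := R_CompleteNormedModule)).
      intros t. rewrite Rmin_left, Rmax_right by lra. auto. }
    set (Y := RInt (fun t => g t * (t ^ 2 - s) * cos (phase s d t)) 0 b) in *.
    generalize (is_RInt_plus _ _ _ _ _ _ Ih (is_RInt_scal _ _ _ (/ (4 * s)) _ Ig)). intros I1.
    assert (IK := is_RInt_continuous (fun t => t * sin (phase s d t)) 0 b
      (fun t => continuous_mulR _ _ t (continuous_id _) (continuous_sin_phase s d t))).
    assert (IJ := is_RInt_continuous _ 0 b (continuous_cos_phase s d)).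
    assert (IJ' := is_RInt_continuous _ 0 b (continuous_cos_phase s (d - PI / 2))).
    generalize (is_RInt_plus _ _ _ _ _ _ (is_RInt_minus _ _ _ _ _ _ IK
       (is_RInt_scal _ _ _ q _ IJ')) (is_RInt_scal _ _ _ (/ (4 * s)) _ IJ)). intros I2.
    assert (E : tsinint_trunc d s b - q * cosint_trunc (d - PI / 2) s b + cosint_trunc d s b / (4 * s) =
       (- cos (phase s d b) / (b + q) + cos d / q) + / (4 * s) * Y).
    { transitivity (plus (minus (RInt (fun t : R => t * sin (phase s d t)) 0 b)
        (scal q (RInt (fun t : R => cos (phase s (d - PI / 2) t)) 0 b)))
       (scal (/ (4 * s)) (RInt (fun t : R => cos (phase s d t)) 0 b))).
      { unfold plus, minus, scal, opp; simpl; unfold mult; simpl. fold (tsinint_trunc d s b).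
        fold (cosint_trunc d s b). fold (cosint_trunc (d - PI / 2) s b). eqR.
        unfold plus, opp; simpl. unfold Rdiv. ring. }
      transitivity (plus (- cos (phase s d b) / (b + q) - - cos (phase s d 0) / (0 + q))
         (scal (/ (4 * s)) Y)).
      2: { unfold plus, scal; simpl; unfold mult; simpl. eqR.
           replace (phase s d 0) with d by (unfold phase; field). field. lra. }
      etransitivity. symmetry. exact (is_RInt_unique _ _ _ _ I2).
      etransitivity. 2: exact (is_RInt_unique _ _ _ _ I1).
      apply RInt_ext_le. lra. intros t Ht.
      unfold plus, minus, scal, opp; simpl; unfold mult; simpl.
      unfold plus, opp; simpl. eqR. rewrite <- sin_phase. unfold h', g. rewrite <- qq.
      field. lra. }
    rewrite E.
    replace (- cos (phase s d b) / (b + q) + cos d / q + / (4 * s) * Y - cos d / q) with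
      (/ (4 * s) * Y + - (cos (phase s d b) / (b + q))) by (field; lra).
    eapply Rle_trans. apply Rabs_triang. apply Rplus_le_compat.
    - rewrite Rabs_mult, (Rabs_pos_eq (/ (4 * s))).
      2: apply Rlt_le, Rinv_0_lt_compat; lra.
      replace (3 / (2 * s ^ 2)) with (/ (4 * s) * (2 * g 0)).
      apply Rmult_le_compat_l; auto. apply Rlt_le, Rinv_0_lt_compat; lra.
      unfold g. rewrite <- qq. field. lra.
    - rewrite Rabs_Ropp. unfold Rdiv. rewrite Rabs_mult.
      assert (Rabs (cos (phase s d b)) <= 1) by (apply Rabs_le, COS_bound).
      rewrite (Rabs_pos_eq (/ (b + q))) by (apply Rlt_le, Rinv_0_lt_compat; lra).
      apply Rmult_le_compat; auto. apply Rabs_pos. apply Rlt_le, Rinv_0_lt_compat; lra.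
      apply Rinv_le_contravar; lra. }
  (* Truncation errors: 1 from the endpoint [b], 4 from [tsinint], [q * 4] from the shifted
     [cosint], 4 from [cosint d s / (4 * s)]. *)
  apply (le_of_le_plus_inv _ _ (2 * s + 2) (1 + 4 + q * 4 + 4)). intros b Hb.
  specialize (F b ltac:(lra)).
  destruct (tsinint_trunc_lim s s d Hs ltac:(lra)) as [_ HK]. specialize (HK b Hb).
  destruct (cosint_trunc_lim s s d Hs ltac:(lra)) as [_ HJ]. specialize (HJ b Hb).
  destruct (cosint_trunc_lim s s (d - PI / 2) Hs ltac:(lra)) as [_ HJ']. specialize (HJ' b Hb).
  apply Rabs_le_between in F, HK, HJ, HJ'.
  assert (0 < / b) by (apply Rinv_0_lt_compat; lra).
  assert (i4 : 0 < / (4 * s) <= 1).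
  { split. apply Rinv_0_lt_compat; lra. rewrite <- Rinv_1. apply Rinv_le_contravar; lra. }
  unfold Rdiv in *. apply Rabs_le.
  assert (Z1 : Rabs (q * (cosint_trunc (d - PI * / 2) s b - cosint (d - PI * / 2) s)) <= q * (4 * / b)).
  { rewrite Rabs_mult, (Rabs_pos_eq q) by lra. apply Rmult_le_compat_l. lra.
    apply Rabs_le; lra. }
  assert (Z2 : Rabs ((cosint_trunc d s b - cosint d s) * / (4 * s)) <= (4 * / b) * 1).
  { rewrite Rabs_mult, (Rabs_pos_eq (/ (4 * s))) by lra. apply Rmult_le_compat.
    apply Rabs_pos. lra. apply Rabs_le; lra. lra. }
  apply Rabs_le_between in Z1, Z2. lra.
Qed.

(** * The damped part of Bi *)

Definition damp (s t : R) : R := exp (- (t ^ 3 / 3 + s * t)).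
Definition dampint_trunc (s b : R) : R := RInt (damp s) 0 b.
Definition tdampint_trunc (s b : R) : R := RInt (fun t => t * damp s t) 0 b.
(** This is pi Hi(-s) for the Scorer function Hi, and [tdampint s] is pi Hi'(-s). The other half of
    Bi = Gi + Hi is [cosint (- (PI / 2)) s], which is pi Gi(-s). *)
Definition dampint (s : R) : R := real (Lim (dampint_trunc s) p_infty).
Definition tdampint (s : R) : R := real (Lim (tdampint_trunc s) p_infty).

Lemma is_derive_damp (s t : R) : is_derive (damp s) t (- (t ^ 2 + s) * damp s t).
Proof.
  unfold damp.
  apply (is_derive_comp (K := R_AbsRing) (V := R_NormedModule) exp
           (fun t => - (t ^ 3 / 3 + s * t))).
  apply is_derive_exp. auto_derive; trivial. field.
Qed.

Lemma is_derive_damp_l (t s : R) : is_derive (fun s => damp s t) s (- t * damp s t).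
Proof.
  unfold damp.
  apply (is_derive_comp (K := R_AbsRing) (V := R_NormedModule) exp
           (fun s => - (t ^ 3 / 3 + s * t))).
  apply is_derive_exp. auto_derive; trivial. ring.
Qed.

Lemma continuous_damp (s t : R) : continuous (damp s) t.
Proof. exact (is_derive_continuous _ _ _ (is_derive_damp s t)). Qed.

Lemma continuous_pow_damp (n : nat) (s t : R) : continuous (fun t => t ^ n * damp s t) t.
Proof. apply continuous_mulR. apply continuous_pow. apply continuous_damp. Qed.

Lemma continuous_id_damp (s t : R) : continuous (fun t => t * damp s t) t.
Proof. apply continuous_mulR. apply continuous_id. apply continuous_damp. Qed.

Lemma continuous_sqr_damp (s t : R) : continuous (fun t => (t ^ 2 + s) * damp s t) t.
Proof.
  apply continuous_mulR. 2: apply continuous_damp.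
  apply (ex_derive_continuous (V := R_NormedModule)). auto_derive; trivial.
Qed.

Lemma damp_pos (s t : R) : 0 < damp s t.
Proof. apply exp_pos. Qed.

Lemma is_RInt_sqr_damp (s a b : R) :
  is_RInt (fun t => (t ^ 2 + s) * damp s t) a b (damp s a - damp s b).
Proof.
  replace (damp s a - damp s b) with (minus (- damp s b) (- damp s a))
    by (unfold minus, plus, opp; simpl; ring).
  apply (is_RInt_derive (fun t => - damp s t)).
  - intros t _. replace ((t ^ 2 + s) * damp s t) with (- (- (t ^ 2 + s) * damp s t)) by ring.
    apply (is_derive_opp (damp s)). apply is_derive_damp.
  - intros t _. apply continuous_sqr_damp.
Qed.

Lemma exp_opp_le (u : R) : 0 < u -> exp (- u) <= / u.
Proof.
  intros Hu. rewrite exp_Ropp. apply Rinv_le_contravar; auto.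
  generalize (exp_ineq1_le u). lra.
Qed.

Lemma damp_le (s b : R) : -1 <= s -> 2 <= b -> damp s b <= 3 / b.
Proof.
  intros Hs Hb. unfold damp.
  (* From [b = 2] on the cubic term is at least [4 * b / 3], while [s * b] is at least [- b]. *)
  assert (b / 3 <= b ^ 3 / 3 + s * b).
  { assert (b * (b * b) >= b * 4) by (apply Rmult_ge_compat_l; nra). simpl. nra. }
  apply Rle_trans with (exp (- (b / 3))).
  - destruct (Req_dec (b / 3) (b ^ 3 / 3 + s * b)) as [->|]. lra.
    apply Rlt_le, exp_increasing. lra.
  - eapply Rle_trans. apply exp_opp_le. lra. apply Req_le. field. lra.
Qed.

(** The majorant [(t ^ 2 + s) * damp s t] has the antiderivative [- damp s t], so the tail is at
    most [damp s b]. For [t >= 2] and [s >= -1] the factor [t ^ 2 + s] exceeds both 1 and [t], which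
    covers the two integrals in use. *)
Lemma damp_tail (f : R -> R) (s b b' : R) : -1 <= s -> 2 <= b <= b' ->
  (forall t, continuous f t) ->
  (forall t, 2 <= t -> 0 <= f t <= (t ^ 2 + s) * damp s t) ->
  Rabs (RInt f 0 b' - RInt f 0 b) <= 3 / b.
Proof.
  intros Hs Hb Cf Hf. rewrite RInt_tail by auto.
  rewrite Rabs_pos_eq.
  - eapply Rle_trans.
    + apply (RInt_le_continuous _ (fun t => (t ^ 2 + s) * damp s t)). lra. auto.
      intros; apply continuous_sqr_damp. intros t Ht. apply Hf. lra.
    + rewrite (is_RInt_unique _ _ _ _ (is_RInt_sqr_damp s b b')).
      generalize (damp_le s b Hs ltac:(lra)) (damp_pos s b'). lra.
  - apply RInt_ge_0_continuous. lra. auto. intros t Ht. apply Hf. lra.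
Qed.

Lemma dampint_trunc_lim (s : R) : -1 <= s ->
  is_lim (dampint_trunc s) p_infty (dampint s) /\ forall b, 2 <= b -> Rabs (dampint_trunc s b - dampint s) <= 3 / b.
Proof.
  intros Hs. apply lim_tail. lra. intros b b' Hb. apply damp_tail with s; auto.
  intros; apply continuous_damp.
  intros t Ht. generalize (damp_pos s t). split. lra.
  rewrite <- (Rmult_1_l (damp s t)) at 1. apply Rmult_le_compat_r; nra.
Qed.

Lemma tdampint_trunc_lim (s : R) : -1 <= s ->
  is_lim (tdampint_trunc s) p_infty (tdampint s) /\ forall b, 2 <= b -> Rabs (tdampint_trunc s b - tdampint s) <= 3 / b.
Proof.
  intros Hs. apply lim_tail. lra. intros b b' Hb.
  apply (damp_tail (fun t => t * damp s t) s); auto.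
  intros; apply continuous_id_damp.
  intros t Ht. generalize (damp_pos s t). split. nra. apply Rmult_le_compat_r; nra.
Qed.

Lemma continuity_2d_damp (u t : R) : continuity_2d_pt damp u t.
Proof.
  unfold damp. apply (continuity_1d_2d_pt_comp exp).
  apply derivable_continuous_pt, derivable_pt_exp.
  apply continuity_2d_pt_opp. apply continuity_2d_pt_plus.
  - apply (continuity_1d_2d_pt_comp (fun v => v ^ 3 / 3) (fun _ v => v)).
    reg. apply continuity_2d_pt_id2.
  - apply continuity_2d_pt_mult. apply continuity_2d_pt_id1. apply continuity_2d_pt_id2.
Qed.

Lemma RInt_opp_continuous (f : R -> R) (a b : R) : (forall t, continuous f t) ->
  RInt (fun t => - f t) a b = - RInt f a b.
Proof.
  intros Hf. apply (RInt_opp (V := R_CompleteNormedModule)).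
  apply (ex_RInt_continuous (V := R_CompleteNormedModule)). auto.
Qed.

Lemma is_derive_dampint_trunc (b s : R) : is_derive (fun s => dampint_trunc s b) s (- tdampint_trunc s b).
Proof.
  unfold tdampint_trunc. rewrite <- RInt_opp_continuous by (intros; apply continuous_id_damp).
  apply (is_derive_RInt_right damp (fun s t => - (t * damp s t))).
  - intros. replace (- (t * damp u t)) with (- t * damp u t) by ring. apply is_derive_damp_l.
  - intros. apply continuity_2d_pt_opp. apply continuity_2d_pt_mult.
    apply continuity_2d_pt_id2. apply continuity_2d_damp.
  - intros. apply continuous_damp.
Qed.

Lemma RInt_sqr_damp (b s : R) :
  RInt (fun t => t ^ 2 * damp s t) 0 b = 1 - damp s b - s * dampint_trunc s b.
Proof.
  generalize (is_RInt_minus _ _ _ _ _ _ (is_RInt_sqr_damp s 0 b)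
     (is_RInt_scal _ _ _ s _ (is_RInt_continuous _ 0 b (continuous_damp s)))).
  intros I.
  rewrite (RInt_ext _ (fun t => minus ((t ^ 2 + s) * damp s t) (scal s (damp s t)))).
  etransitivity. exact (is_RInt_unique _ _ _ _ I).
  unfold minus, plus, opp, scal; simpl; unfold mult; simpl. fold (dampint_trunc s b). eqR.
  replace (damp s 0) with 1. ring. unfold damp.
  replace (- (0 ^ 3 / 3 + s * 0)) with 0 by field. now rewrite exp_0.
  intros t _. unfold minus, plus, opp, scal; simpl; unfold mult; simpl. eqR. ring.
Qed.

Lemma is_derive_tdampint_trunc (b s : R) : is_derive (fun s => tdampint_trunc s b) s (s * dampint_trunc s b + damp s b - 1).
Proof.
  replace (s * dampint_trunc s b + damp s b - 1) with (RInt (fun t => - (t ^ 2 * damp s t)) 0 b).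
  2: { rewrite RInt_opp_continuous by (intros; apply continuous_pow_damp).
       rewrite RInt_sqr_damp. eqR. ring. }
  apply (is_derive_RInt_right (fun s t => t * damp s t) (fun s t => - (t ^ 2 * damp s t))).
  - intros. replace (- (t ^ 2 * damp u t)) with (t * (- t * damp u t)) by ring.
    apply is_derive_scal. apply is_derive_damp_l.
  - intros. apply continuity_2d_pt_opp. apply continuity_2d_pt_mult.
    apply (continuity_1d_2d_pt_comp (fun v => v ^ 2) (fun _ v => v)).
    reg. apply continuity_2d_pt_id2. apply continuity_2d_damp.
  - intros. apply continuous_id_damp.
Qed.

Lemma is_derive_dampint (s : R) : 0 <= s -> is_derive dampint s (- tdampint s).
Proof.
  intros Hs.
  apply (derive_limit (fun b s => dampint_trunc s b) (fun b s => - tdampint_trunc s b) dampint (fun s => - tdampint s) s 2 3).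
  - intros; apply is_derive_dampint_trunc.
  - intros b y Hb Hy. apply Rabs_def2 in Hy. apply dampint_trunc_lim; lra.
  - intros b y Hb Hy. apply Rabs_def2 in Hy.
    replace (- _ - - _) with (- (tdampint_trunc y b - tdampint y)) by ring. rewrite Rabs_Ropp. apply tdampint_trunc_lim; lra.
Qed.

Lemma is_derive_tdampint (s : R) : 0 <= s -> is_derive tdampint s (s * dampint s - 1).
Proof.
  intros Hs.
  apply (derive_limit (fun b s => tdampint_trunc s b) (fun b s => s * dampint_trunc s b + damp s b - 1) tdampint
           (fun s => s * dampint s - 1) s 2 (3 * (s + 1) + 3)).
  - intros; apply is_derive_tdampint_trunc.
  - intros b y Hb Hy. apply Rabs_def2 in Hy. destruct (tdampint_trunc_lim y ltac:(lra)) as [_ L].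
    eapply Rle_trans. apply L; lra. apply Rmult_le_compat_r.
    apply Rlt_le, Rinv_0_lt_compat; lra. lra.
  - intros b y Hb Hy. apply Rabs_def2 in Hy. destruct (dampint_trunc_lim y ltac:(lra)) as [_ L].
    specialize (L b Hb).
    replace (_ - _) with (y * (dampint_trunc y b - dampint y) + damp y b) by ring.
    eapply Rle_trans. apply Rabs_triang. rewrite (Rabs_pos_eq (damp y b))
      by apply Rlt_le, damp_pos. rewrite Rabs_mult.
    assert (Rabs y <= s + 1) by (apply Rabs_le; lra).
    generalize (damp_le y b ltac:(lra) Hb).
    assert (Rabs y * Rabs (dampint_trunc y b - dampint y) <= (s + 1) * (3 / b)).
    { apply Rmult_le_compat; auto using Rabs_pos. }
    unfold Rdiv in *. nra.
Qed.

Lemma RInt_exp_moments (s b : R) : 0 < s -> 0 <= b ->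
  RInt (fun t => exp (- (s * t))) 0 b <= / s /\
  RInt (fun t => t * exp (- (s * t))) 0 b <= / s ^ 2 /\
  RInt (fun t => t ^ 2 * exp (- (s * t))) 0 b <= 2 / s ^ 3.
Proof.
  intros Hs Hb.
  (* Each antiderivative [P] below is minus a polynomial times the exponential, so [P b <= 0], and
     [- P 0] is the moment over the whole half line. *)
  assert (K : forall (f P : R -> R), (forall t, continuous f t) ->
     (forall t, is_derive P t (f t)) -> P b <= 0 -> RInt f 0 b <= - P 0).
  { intros f P Cf DP HP. rewrite (is_RInt_unique f 0 b (P b - P 0)). lra.
    apply (is_RInt_derive P); auto. }
  assert (e0 : exp (- (s * 0)) = 1).
  { replace (- (s * 0)) with 0 by ring. apply exp_0. }
  assert (is : 0 < / s) by now apply Rinv_0_lt_compat.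
  generalize (exp_pos (- (s * b))); intros eb.
  repeat split.
  - replace (/ s) with (- (- (exp (- (s * 0)) * / s))) by (rewrite e0; field; lra).
    apply (K _ (fun t => - (exp (- (s * t)) * / s))).
    + intros t. apply (ex_derive_continuous (V := R_NormedModule)). auto_derive; trivial.
    + intros t. auto_derive; trivial. field. lra.
    + nra.
  - replace (/ s ^ 2) with (- (- (exp (- (s * 0)) * (0 * / s + / s * / s))))
      by (rewrite e0; field; lra).
    apply (K _ (fun t => - (exp (- (s * t)) * (t * / s + / s * / s)))).
    + intros t. apply (ex_derive_continuous (V := R_NormedModule)). auto_derive; trivial.
    + intros t. auto_derive; trivial. field. lra.
    + assert (0 <= b * / s + / s * / s) by nra. nra.
  - replace (2 / s ^ 3) with (- (- (exp (- (s * 0)) *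
        (0 ^ 2 * / s + 2 * 0 * (/ s * / s) + 2 * (/ s * / s * / s))))) by (rewrite e0; field; lra).
    apply (K _ (fun t => - (exp (- (s * t)) *
        (t ^ 2 * / s + 2 * t * (/ s * / s) + 2 * (/ s * / s * / s))))).
    + intros t. apply (ex_derive_continuous (V := R_NormedModule)). auto_derive; trivial.
    + intros t. auto_derive; trivial. field. lra.
    + assert (0 < / s * / s) by nra. assert (0 < / s * / s * / s) by nra.
      assert (0 <= b ^ 2 * / s + 2 * b * (/ s * / s) + 2 * (/ s * / s * / s)).
      { assert (0 <= b ^ 2 * / s) by (apply Rmult_le_pos; nra). nra. }
      nra.
Qed.

Lemma damp_le_exp (s t : R) : 0 <= t -> damp s t <= exp (- (s * t)).
Proof.
  intros Ht. unfold damp. assert (0 <= t ^ 3) by now apply pow_le.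
  destruct (Req_dec (t ^ 3) 0) as [->|].
  right; f_equal; field.
  apply Rlt_le, exp_increasing. lra.
Qed.

(** By [RInt_sqr_damp], [1 - s * dampint s] is the second moment of [damp s] over the half line. Its
    smallness is what makes [resAi_bound] possible. *)
Lemma dampint_bounds (s : R) : 0 < s ->
  0 <= dampint s <= / s /\ 0 <= tdampint s <= / s ^ 2 /\ 0 <= 1 - s * dampint s <= 2 / s ^ 3.
Proof.
  intros Hs.
  destruct (dampint_trunc_lim s ltac:(lra)) as [_ LG]. destruct (tdampint_trunc_lim s ltac:(lra)) as [_ LH].
  assert (CE : forall n t, continuous (fun t => t ^ n * exp (- (s * t))) t).
  { intros n t. apply continuous_mulR. apply continuous_pow.
    apply (ex_derive_continuous (V := R_NormedModule)). auto_derive; trivial. }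
  assert (M : forall b, 2 <= b -> 0 <= dampint_trunc s b <= / s /\ 0 <= tdampint_trunc s b <= / s ^ 2 /\
      0 <= 1 - damp s b - s * dampint_trunc s b <= 2 / s ^ 3).
  { intros b Hb. destruct (RInt_exp_moments s b Hs ltac:(lra)) as [M0 [M1 M2]].
    rewrite <- RInt_sqr_damp. unfold dampint_trunc, tdampint_trunc.
    split; [split | split; [split | split]].
    - apply RInt_ge_0_continuous. lra. apply continuous_damp.
      intros; apply Rlt_le, damp_pos.
    - eapply Rle_trans. 2: exact M0. apply RInt_le_continuous. lra.
      intros; apply continuous_damp.
      intros t; apply (ex_derive_continuous (V := R_NormedModule)). auto_derive; trivial.
      intros t Ht. apply damp_le_exp. lra.
    - apply RInt_ge_0_continuous. lra. apply continuous_id_damp.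
      intros t Ht; apply Rmult_le_pos. lra. apply Rlt_le, damp_pos.
    - eapply Rle_trans. 2: exact M1. apply RInt_le_continuous. lra.
      intros; apply continuous_id_damp.
      intros t; apply (ex_derive_continuous (V := R_NormedModule)). auto_derive; trivial.
      intros t Ht. apply Rmult_le_compat_l. lra. apply damp_le_exp. lra.
    - apply RInt_ge_0_continuous. lra. apply continuous_pow_damp.
      intros t Ht; apply Rmult_le_pos. nra. apply Rlt_le, damp_pos.
    - eapply Rle_trans. 2: exact M2. apply RInt_le_continuous. lra.
      intros; apply continuous_pow_damp. auto.
      intros t Ht. apply Rmult_le_compat_l. nra. apply damp_le_exp. lra. }
  assert (M' : forall b, 2 <= b -> 0 < 3 / b /\ -(3/b) <= dampint_trunc s b - dampint s <= 3 / b /\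
      -(3/b) <= tdampint_trunc s b - tdampint s <= 3 / b /\ 0 < damp s b <= 3 / b).
  { intros b Hb. split. apply Rdiv_lt_0_compat; lra. split. apply Rabs_le_between; auto.
    split. apply Rabs_le_between; auto. split. apply damp_pos. apply damp_le; lra. }
  repeat split.
  - apply (le_of_le_plus_inv _ _ 2 3). intros b Hb.
    specialize (M b Hb). specialize (M' b Hb). lra.
  - apply (le_of_le_plus_inv _ _ 2 3). intros b Hb.
    specialize (M b Hb). specialize (M' b Hb). lra.
  - apply (le_of_le_plus_inv _ _ 2 3). intros b Hb.
    specialize (M b Hb). specialize (M' b Hb). lra.
  - apply (le_of_le_plus_inv _ _ 2 3). intros b Hb.
    specialize (M b Hb). specialize (M' b Hb). lra.
  - apply (le_of_le_plus_inv _ _ 2 (s * 3)). intros b Hb.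
    specialize (M b Hb). specialize (M' b Hb). unfold Rdiv in *. nra.
  - apply (le_of_le_plus_inv _ _ 2 (s * 3 + 3)). intros b Hb.
    specialize (M b Hb). specialize (M' b Hb). unfold Rdiv in *. nra.
Qed.

(** * Airy functions on the negative axis *)

Definition piBi (s : R) : R := dampint s + cosint (- (PI / 2)) s.
Definition piAi (s : R) : R := cosint 0 s.
Definition dpiBi (s : R) : R := - tdampint s + tsinint (- (PI / 2)) s.
Definition dpiAi (s : R) : R := tsinint 0 s.

Lemma Ai_opp (s : R) : Ai (- s) = / PI * piAi s.
Proof.
  unfold Ai, piAi, cosint. do 2 f_equal. apply Lim_ext. intros b. unfold cosint_trunc.
  apply RInt_ext. intros t _. eqR. f_equal. unfold phase; ring.
Qed.

(** [Bi] takes a single limit of a sum of two integrands. It splits because both limits are finite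
    when [0 <= s]. *)
Lemma Bi_opp (s : R) : 0 <= s -> Bi (- s) = / PI * piBi s.
Proof.
  intros Hs. unfold Bi, piBi. f_equal.
  rewrite (Lim_ext (fun b => dampint_trunc s b + cosint_trunc (- (PI / 2)) s b)).
  - assert (L : is_lim (fun b => dampint_trunc s b + cosint_trunc (- (PI / 2)) s b) p_infty
                  (Finite (dampint s + cosint (- (PI / 2)) s))).
    { apply (is_lim_plus _ _ _ (dampint s) (cosint (- (PI / 2)) s)).
      apply dampint_trunc_lim; lra.
      apply (cosint_trunc_lim (s + 1)); lra. reflexivity. }
    rewrite (is_lim_unique _ _ _ L). reflexivity.
  - intros b. unfold dampint_trunc, cosint_trunc.
    assert (IG := is_RInt_continuous _ 0 b (continuous_damp s)).
    assert (IJ := is_RInt_continuous _ 0 b (continuous_cos_phase s (- (PI / 2)))).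
    generalize (is_RInt_plus _ _ _ _ _ _ IG IJ). intros I.
    etransitivity. symmetry. exact (is_RInt_unique _ _ _ _ I).
    apply RInt_ext. intros t _. unfold plus; simpl. eqR. symmetry. f_equal.
    + unfold damp. f_equal. unfold Rdiv. ring.
    + replace (- (PI / 2)) with (0 - PI / 2) by ring. rewrite <- sin_phase. f_equal. unfold phase. field.
Qed.

Lemma cosint_sub_PI (d s : R) : cosint (d - PI) s = - cosint d s.
Proof.
  unfold cosint. rewrite (Lim_ext (fun b => - cosint_trunc d s b)).
  - rewrite Lim_opp. destruct (Lim (cosint_trunc d s) p_infty); simpl; ring.
  - intros b. unfold cosint_trunc. rewrite <- RInt_opp_continuous by (intros; apply continuous_cos_phase).
    apply RInt_ext. intros t _. eqR.
    replace (phase s (d - PI) t) with (- (PI - phase s d t)) by (unfold phase; ring).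
    rewrite cos_neg. rewrite Rtrigo_facts.cos_pi_minus. ring.
Qed.

Lemma is_derive_piBi (s : R) : 0 <= s -> is_derive piBi s (dpiBi s).
Proof.
  intros Hs. apply (is_derive_plus dampint (cosint (- (PI / 2)))).
  apply is_derive_dampint, Hs. apply is_derive_cosint, Hs.
Qed.

Lemma is_derive_piAi (s : R) : 0 <= s -> is_derive piAi s (dpiAi s).
Proof. apply is_derive_cosint. Qed.

(** Each half of Bi solves only an inhomogeneous Airy equation: the endpoint 0 contributes 1 through
    the damped integral and [sin (- (PI / 2)) = -1] through the oscillatory one. The two cancel. *)
Lemma is_derive_dpiBi (s : R) : 0 <= s -> is_derive dpiBi s (- s * piBi s).
Proof.
  intros Hs. replace (- s * piBi s) with
    (- (s * dampint s - 1) + (- s * cosint (- (PI / 2)) s + sin (- (PI / 2)))).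
  apply (is_derive_plus (fun s => - tdampint s) (tsinint (- (PI / 2)))).
  apply (is_derive_opp tdampint). apply is_derive_tdampint, Hs. apply is_derive_tsinint, Hs.
  unfold piBi. rewrite sin_neg, sin_PI2. ring.
Qed.

Lemma is_derive_dpiAi (s : R) : 0 <= s -> is_derive dpiAi s (- s * piAi s).
Proof.
  intros Hs. replace (- s * piAi s) with (- s * cosint 0 s + sin 0).
  apply is_derive_tsinint, Hs. rewrite sin_0. unfold piAi; ring.
Qed.

(** This is the nonzero value that [wronskian_pos] contradicts. The damped integral over [0, 1] is
    at least 2/3; the sine is nonnegative up to [t = 2], since 8/3 < PI; beyond 2, [osc_bound] with
    amplitude [1 / t ^ 2] bounds the rest by 1/2. *)
Lemma piBi_0_pos : 0 < piBi 0.
Proof.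
  apply Rlt_le_trans with (2 / 3 - 1 / 2). lra.
  (* 4 is the threshold [2 * S + 2] for [S = 1], and 7 = 3 + 4 adds the truncation rates of the two
     halves. *)
  apply (le_of_le_plus_inv _ _ 4 7). intros b Hb.
  destruct (dampint_trunc_lim 0 ltac:(lra)) as [_ LG]. specialize (LG b ltac:(lra)).
  destruct (cosint_trunc_lim 1 0 (- (PI / 2)) ltac:(lra) ltac:(lra)) as [_ LJ].
  specialize (LJ b ltac:(lra)).
  apply Rabs_le_between in LG, LJ.
  assert (X : forall (f : R -> R) u v, (forall t, continuous f t) -> ex_RInt f u v)
    by (intros; apply (ex_RInt_continuous (V := R_CompleteNormedModule)); auto).
  assert (A1 : 2 / 3 <= dampint_trunc 0 b).
  { unfold dampint_trunc.
    rewrite <- (RInt_Chasles (damp 0) 0 1 b) by (apply X, continuous_damp).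
    unfold plus; simpl.
    assert (0 <= RInt (damp 0) 1 b).
    { apply RInt_ge_0_continuous. lra. apply continuous_damp.
      intros; apply Rlt_le, damp_pos. }
    assert (L1 : RInt (fun _ => 2 / 3) 0 1 <= RInt (damp 0) 0 1).
    { apply RInt_le_continuous. lra. intros; apply continuous_const. apply continuous_damp.
      intros t Ht. unfold damp.
      generalize (exp_ineq1_le (- (t ^ 3 / 3 + 0 * t))).
      assert (t ^ 3 <= 1 ^ 3) by (apply pow_incr; lra). simpl in *; lra. }
    rewrite RInt_const in L1. unfold scal in L1; simpl in L1; unfold mult in L1; simpl in L1.
    lra. }
  assert (A2 : - (1 / 2) <= cosint_trunc (- (PI / 2)) 0 b).
  { unfold cosint_trunc.
    rewrite <- (RInt_Chasles _ 0 2 b) by (apply X, continuous_cos_phase).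
    unfold plus; simpl.
    assert (0 <= RInt (fun t => cos (phase 0 (- (PI / 2)) t)) 0 2).
    { apply RInt_ge_0_continuous. lra. apply continuous_cos_phase. intros t Ht.
      replace (- (PI / 2)) with (0 - PI / 2) by ring. rewrite <- sin_phase. unfold phase.
      generalize PI2_3_2. intros.
      assert (0 <= t ^ 3 <= 2 ^ 3) by (split; [apply pow_le | apply pow_incr]; lra).
      apply sin_ge_0; simpl in *; lra. }
    assert (L2 : Rabs (RInt (fun t => cos (phase 0 (- (PI / 2)) t)) 2 b) <= 2 * (/ 2 ^ 2)).
    { rewrite (RInt_ext_le _ (fun t => / t ^ 2 * (t ^ 2 - 0) * cos (phase 0 (- (PI / 2)) t))).
      - apply (osc_bound 0 _ 2 b (fun t => / t ^ 2) (fun t => - (2 / t ^ 3))).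
        + lra.
        + intros t Ht. auto_derive. apply Rgt_not_eq. apply (pow_lt t 2); lra. field. lra.
        + intros t Ht. apply (ex_derive_continuous (V := R_NormedModule)). auto_derive.
          apply Rgt_not_eq. apply (pow_lt t 3); lra.
        + intros t Ht. assert (0 < 2 / t ^ 3) by (apply Rdiv_lt_0_compat; [|apply pow_lt]; lra).
          lra.
        + apply Rlt_le, Rinv_0_lt_compat, pow_lt; lra.
      - lra.
      - intros t Ht. field. lra. }
    apply Rabs_le_between in L2. simpl in *. lra. }
  unfold piBi. unfold Rdiv in *. lra.
Qed.

(* Real and imaginary parts of [Z' - (i sqrt s - 1 / (4 s)) Z] for [Z = piBi + i piAi]. *)
Definition resBi (s : R) : R := dpiBi s + sqrt s * piAi s + piBi s / (4 * s).
Definition resAi (s : R) : R := dpiAi s - sqrt s * piBi s + piAi s / (4 * s).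

(** For [d = - (PI / 2)] the endpoint term [cos d / sqrt s] vanishes, and the damped integrals are
    of order 1/s^2 by themselves. *)
Lemma resBi_bound (s : R) : 2 <= s -> Rabs (resBi s) <= 3 / s ^ 2.
Proof.
  intros Hs. generalize (osc_asymptotics s (- (PI / 2)) ltac:(lra)).
  replace (- (PI / 2) - PI / 2) with (0 - PI) by field.
  rewrite cosint_sub_PI, cos_neg, cos_PI2. intros O.
  destruct (dampint_bounds s ltac:(lra)) as [HG [HH _]].
  apply Rabs_le_between in O. apply Rabs_le.
  assert (E : resBi s = (tsinint (- (PI / 2)) s - sqrt s * - cosint 0 s + cosint (- (PI / 2)) s / (4 * s)
     - 0 / sqrt s) + (- tdampint s + dampint s * / (4 * s))).
  { unfold resBi, dpiBi, piBi, piAi. assert (0 < sqrt s) by (apply sqrt_lt_R0; lra).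
    field. lra. }
  rewrite E.
  assert (0 < / s) by (apply Rinv_0_lt_compat; lra).
  assert (Q : / s ^ 2 = / s * / s) by (field; lra).
  assert (dampint s * / (4 * s) <= / s ^ 2).
  { rewrite Q, Rinv_mult. nra. }
  assert (0 <= dampint s * / (4 * s)) by (rewrite Rinv_mult; nra).
  replace (3 / (2 * s ^ 2)) with (3 / 2 * / s ^ 2) in O by (field; lra).
  unfold Rdiv at 1 3. lra.
Qed.

(** For [d = 0] the endpoint term [1 / sqrt s] is too large. The damped half of [sqrt s * piBi s]
    cancels it up to [(1 - s * dampint s) / sqrt s]. *)
Lemma resAi_bound (s : R) : 2 <= s -> Rabs (resAi s) <= 3 / s ^ 2.
Proof.
  intros Hs. generalize (osc_asymptotics s 0 ltac:(lra)).
  rewrite Rminus_0_l, cos_0. intros O.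
  destruct (dampint_bounds s ltac:(lra)) as [HG [_ HH]].
  assert (q0 : 1 <= sqrt s) by (rewrite <- sqrt_1; apply sqrt_le_1_alt; lra).
  apply Rabs_le_between in O. apply Rabs_le.
  assert (qq : sqrt s * sqrt s = s) by (apply sqrt_sqrt; lra).
  assert (E : resAi s = (tsinint 0 s - sqrt s * cosint (- (PI / 2)) s + cosint 0 s / (4 * s)
     - 1 / sqrt s) + (1 - s * dampint s) / sqrt s).
  { unfold resAi, dpiAi, piBi, piAi.
    replace (1 - s * dampint s) with (1 - sqrt s * sqrt s * dampint s) by (rewrite qq; ring).
    field. lra. }
  rewrite E.
  assert (0 <= (1 - s * dampint s) / sqrt s <= 1 * / s ^ 2).
  { assert (0 < / sqrt s <= 1).
    { split. apply Rinv_0_lt_compat; lra. rewrite <- Rinv_1. apply Rinv_le_contravar; lra. }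
    assert (1 - s * dampint s <= 1 * / s ^ 2).
    { apply Rle_trans with (2 / s ^ 3). lra.
      replace (2 / s ^ 3) with ((2 / s) * / s ^ 2) by (field; lra).
      apply Rmult_le_compat_r. apply Rlt_le, Rinv_0_lt_compat, pow_lt; lra.
      apply Rmult_le_reg_r with s. lra. field_simplify; lra. }
    unfold Rdiv. split. nra. nra. }
  assert (0 < / s ^ 2) by (apply Rinv_0_lt_compat, pow_lt; lra).
  replace (3 / (2 * s ^ 2)) with (3 / 2 * / s ^ 2) in O by (field; lra).
  unfold Rdiv in *. lra.
Qed.

(** * The modulus *)

Definition wronskian (s : R) : R := piBi s * dpiAi s - piAi s * dpiBi s.
Definition modsq (s : R) : R := piBi s ^ 2 + piAi s ^ 2.
Definition dmodsq (s : R) : R := 2 * (piBi s * dpiBi s + piAi s * dpiAi s).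

Lemma is_derive_mulR (f g : R -> R) (x df dg : R) :
  is_derive f x df -> is_derive g x dg ->
  is_derive (fun x => f x * g x) x (df * g x + f x * dg).
Proof. intros Hf Hg. exact (is_derive_mult f g x df dg Hf Hg Rmult_comm). Qed.

Lemma is_derive_modsq (s : R) : 0 <= s -> is_derive modsq s (dmodsq s).
Proof.
  intros Hs. unfold dmodsq.
  replace (2 * (piBi s * dpiBi s + piAi s * dpiAi s)) with
    ((dpiBi s * piBi s + piBi s * dpiBi s) + (dpiAi s * piAi s + piAi s * dpiAi s)) by ring.
  apply (is_derive_ext (fun s => piBi s * piBi s + piAi s * piAi s)).
  intros t. unfold modsq. eqR. ring.
  apply (is_derive_plus (fun s => piBi s * piBi s) (fun s => piAi s * piAi s));
    apply is_derive_mulR; first [now apply is_derive_piBi | now apply is_derive_piAi].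
Qed.

Lemma wronskian_const (s : R) : 0 <= s -> wronskian s = wronskian 0.
Proof.
  intros Hs.
  destruct (MVT_gen wronskian 0 s (fun _ => 0)) as [c [_ Hc]]; try lra.
  - intros x. rewrite Rmin_left, Rmax_right by lra. intros Hx.
    replace 0 with ((dpiBi x * dpiAi x + piBi x * (- x * piAi x)) - (dpiAi x * dpiBi x + piAi x * (- x * piBi x)))
      by ring.
    apply (is_derive_minus (fun s => piBi s * dpiAi s) (fun s => piAi s * dpiBi s)).
    apply is_derive_mulR. apply is_derive_piBi; lra. apply is_derive_dpiAi; lra.
    apply is_derive_mulR. apply is_derive_piAi; lra. apply is_derive_dpiBi; lra.
  - intros x. rewrite Rmin_left, Rmax_right by lra. intros Hx.
    apply continuity_pt_filterlim.
    apply (continuous_minus (V := R_NormedModule) (fun s => piBi s * dpiAi s) (fun s => piAi s * dpiBi s));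
    apply continuous_mulR; eapply is_derive_continuous.
    apply is_derive_piBi; lra. apply is_derive_dpiAi; lra.
    apply is_derive_piAi; lra. apply is_derive_dpiBi; lra.
Qed.

Lemma modsq_nonneg (s : R) : 0 <= modsq s.
Proof. unfold modsq. nra. Qed.

Lemma abs_le_sqrt_modsq (s : R) :
  Rabs (piBi s) <= sqrt (modsq s) /\ Rabs (piAi s) <= sqrt (modsq s).
Proof.
  unfold modsq. split; rewrite <- sqrt_Rsqr_abs; apply sqrt_le_1_alt; unfold Rsqr; nra.
Qed.

Lemma abs_bilinear_le (a b p r y e : R) : Rabs a <= y -> Rabs b <= y -> Rabs p <= e ->
  Rabs r <= e -> Rabs (a * p + b * r) <= 2 * (y * e).
Proof.
  intros. eapply Rle_trans. apply Rabs_triang. rewrite !Rabs_mult.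
  assert (Rabs a * Rabs p <= y * e) by (apply Rmult_le_compat; auto using Rabs_pos).
  assert (Rabs b * Rabs r <= y * e) by (apply Rmult_le_compat; auto using Rabs_pos). lra.
Qed.

(** [wronskian] is the imaginary part of conj(Z) Z', and [dmodsq] is twice its real part. Inserting
    the approximation of Z' gives this bound and [dmodsq_approx]; the error is linear in |Z|, the
    main term quadratic. *)
Lemma wronskian_approx (s : R) : 2 <= s ->
  Rabs (wronskian s - sqrt s * modsq s) <= 6 * sqrt (modsq s) / s ^ 2.
Proof.
  intros Hs. destruct (abs_le_sqrt_modsq s) as [HU HV].
  replace (wronskian s - sqrt s * modsq s) with (piBi s * resAi s + piAi s * (- resBi s)).
  2: { unfold wronskian, modsq, resBi, resAi. field. lra. }
  replace (6 * sqrt (modsq s) / s ^ 2) with (2 * (sqrt (modsq s) * (3 / s ^ 2))) by (field; lra).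
  apply abs_bilinear_le; auto using resAi_bound. rewrite Rabs_Ropp. now apply resBi_bound.
Qed.

Lemma dmodsq_approx (s : R) : 2 <= s ->
  Rabs (dmodsq s + modsq s / (2 * s)) <= 12 * sqrt (modsq s) / s ^ 2.
Proof.
  intros Hs. destruct (abs_le_sqrt_modsq s) as [HU HV].
  replace (dmodsq s + modsq s / (2 * s)) with (2 * (piBi s * resBi s + piAi s * resAi s)).
  2: { unfold dmodsq, modsq, resBi, resAi. field. lra. }
  rewrite Rabs_mult, (Rabs_pos_eq 2) by lra.
  replace (12 * sqrt (modsq s) / s ^ 2) with (2 * (2 * (sqrt (modsq s) * (3 / s ^ 2))))
    by (field; lra).
  apply Rmult_le_compat_l. lra.
  apply abs_bilinear_le; auto using resBi_bound, resAi_bound.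
Qed.

(** Since piBi'' = - s piBi, the derivative of the energy collapses to [piBi s ^ 2]. *)
Lemma energy_nondecreasing (a b : R) : 0 <= a <= b ->
  dpiBi a ^ 2 + a * piBi a ^ 2 <= dpiBi b ^ 2 + b * piBi b ^ 2.
Proof.
  intros Hab. set (e := fun s => dpiBi s * dpiBi s + s * (piBi s * piBi s)).
  assert (De : forall s, 0 <= s -> is_derive e s (piBi s * piBi s)).
  { intros s Hs. replace (piBi s * piBi s) with
      ((- s * piBi s * dpiBi s + dpiBi s * (- s * piBi s)) +
       (1 * (piBi s * piBi s) + s * (dpiBi s * piBi s + piBi s * dpiBi s))) by ring.
    apply (is_derive_plus (fun s => dpiBi s * dpiBi s) (fun s => s * (piBi s * piBi s))).
    apply is_derive_mulR; now apply is_derive_dpiBi.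
    apply (is_derive_mulR (fun s => s) (fun s => piBi s * piBi s)).
    apply is_derive_Reals, derivable_pt_lim_id.
    apply is_derive_mulR; now apply is_derive_piBi. }
  destruct (MVT_gen e a b (fun s => piBi s * piBi s)) as [c [Hc Ec]].
  - intros x. rewrite Rmin_left, Rmax_right by lra. intros; apply De; lra.
  - intros x. rewrite Rmin_left, Rmax_right by lra. intros.
    apply continuity_pt_filterlim. eapply is_derive_continuous. apply De; lra.
  - unfold e in Ec. nra.
Qed.

(* If the Wronskian were nonpositive, [wronskian_approx] would force piBi and piBi' to
   decay, hence the nondecreasing energy [piBi' ^ 2 + s piBi ^ 2] to vanish. *)
Lemma wronskian_pos : 0 < wronskian 0.
Proof.
  apply Rnot_le_lt. intros HW.
  (* A nonpositive Wronskian leaves [sqrt s * modsq s] bounded by the error term alone, and division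
     by |Z| gives [q * y <= 6 / s ^ 2]. Then |piBi'| is at most (3 + 6 + 6) / s^2, and 261 = 15^2 +
     6^2. *)
  assert (Dec : forall s, 2 <= s -> dpiBi s ^ 2 + s * piBi s ^ 2 <= 0 + 261 / s).
  { intros s Hs.
    generalize (wronskian_approx s Hs). rewrite wronskian_const by lra. intros A.
    destruct (abs_le_sqrt_modsq s) as [HU HV].
    generalize (resBi_bound s Hs). intros P.
    assert (yy : sqrt (modsq s) * sqrt (modsq s) = modsq s) by apply sqrt_sqrt, modsq_nonneg.
    assert (qq : sqrt s * sqrt s = s) by (apply sqrt_sqrt; lra).
    assert (q1 : 1 <= sqrt s) by (rewrite <- sqrt_1; apply sqrt_le_1_alt; lra).
    generalize (sqrt_pos (modsq s)). intros y0.
    set (y := sqrt (modsq s)) in *. set (q := sqrt s) in *.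
    assert (is2 : 0 < / s ^ 2) by (apply Rinv_0_lt_compat, pow_lt; lra).
    assert (Hqy : q * y <= 6 * / s ^ 2).
    { destruct (Req_dec y 0) as [->|]. lra.
      apply Rabs_le_between in A. unfold Rdiv in A. rewrite <- yy in A.
      apply Rmult_le_reg_r with y; lra. }
    assert (HDU : Rabs (dpiBi s) <= 15 * / s ^ 2).
    { replace (dpiBi s) with (resBi s + - (q * piAi s) + - (piBi s * / (4 * s))).
      2: { unfold resBi. fold q. unfold Rdiv. ring. }
      eapply Rle_trans. apply Rabs_triang.
      assert (Rabs (- (q * piAi s)) <= 6 * / s ^ 2).
      { rewrite Rabs_Ropp, Rabs_mult, (Rabs_pos_eq q) by lra.
        eapply Rle_trans. 2: exact Hqy. apply Rmult_le_compat_l; lra. }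
      assert (Rabs (- (piBi s * / (4 * s))) <= 6 * / s ^ 2).
      { rewrite Rabs_Ropp, Rabs_mult.
        assert (0 < / (4 * s) <= 1).
        { split. apply Rinv_0_lt_compat; lra. rewrite <- Rinv_1.
          apply Rinv_le_contravar; lra. }
        rewrite (Rabs_pos_eq (/ (4 * s))) by lra.
        generalize (Rabs_pos (piBi s)). nra. }
      generalize (Rabs_triang (resBi s) (- (q * piAi s))). unfold Rdiv in P. lra. }
    assert (HqU : Rabs (q * piBi s) <= 6 * / s ^ 2).
    { rewrite Rabs_mult, (Rabs_pos_eq q) by lra.
      eapply Rle_trans. 2: exact Hqy. apply Rmult_le_compat_l; lra. }
    replace (dpiBi s ^ 2 + s * piBi s ^ 2) with (dpiBi s ^ 2 + (q * piBi s) ^ 2) by (rewrite <- qq; ring).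
    rewrite <- (pow2_abs (dpiBi s)), <- (pow2_abs (q * piBi s)).
    assert (Rabs (dpiBi s) ^ 2 <= (15 * / s ^ 2) ^ 2) by (apply pow_incr; auto using Rabs_pos).
    assert (Rabs (q * piBi s) ^ 2 <= (6 * / s ^ 2) ^ 2) by (apply pow_incr; auto using Rabs_pos).
    assert ((/ s ^ 2) ^ 2 <= / s).
    { assert (0 < / s <= 1).
      { split. apply Rinv_0_lt_compat; lra. rewrite <- Rinv_1. apply Rinv_le_contravar; lra. }
      replace (/ s ^ 2) with (/ s * / s) by (field; lra).
      assert (/ s * / s <= 1) by nra. assert (0 < / s * / s) by nra.
      assert (/ s * / s <= / s) by nra. nra. }
    unfold Rdiv. lra. }
  assert (Z : forall s, 0 < s -> piBi s = 0).
  { intros s Hs.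
    assert (dpiBi s ^ 2 + s * piBi s ^ 2 <= 0).
    { apply (le_of_le_plus_inv _ _ (Rmax 2 s) 261). intros b Hb.
      generalize (Rmax_l 2 s) (Rmax_r 2 s); intros.
      eapply Rle_trans. apply (energy_nondecreasing s b); lra. apply Dec; lra. }
    assert (0 <= dpiBi s ^ 2) by apply pow2_ge_0. assert (0 <= piBi s ^ 2) by apply pow2_ge_0.
    assert (piBi s ^ 2 = 0) by nra. nra. }
  (* [piBi] vanishes on the open half line; continuity at 0 extends this to [piBi 0]. *)
  assert (CU : continuous piBi 0) by (eapply is_derive_continuous; apply is_derive_piBi; lra).
  apply continuity_pt_filterlim in CU.
  destruct (CU (piBi 0) piBi_0_pos) as [e [He HC]].
  specialize (HC (e / 2)). simpl in HC. unfold R_dist, Rdist in HC.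
  assert (X : Rabs (piBi (e / 2) - piBi 0) < piBi 0).
  { apply HC. split. unfold D_x, no_cond. split; auto. lra.
    rewrite Rminus_0_r, Rabs_pos_eq; lra. }
  rewrite Z in X by lra. rewrite Rminus_0_l, Rabs_Ropp in X.
  generalize (Rle_abs (piBi 0)). lra.
Qed.

(** This is a bootstrap, because both errors involve |Z| itself. A crude upper bound on |Z| makes
    the error in the Wronskian small against W; the resulting lower bound on |Z| makes the error in
    [dmodsq] at most half of its main term. *)
Lemma modsq_asymptotics :
  exists W S0, 0 < W /\ 2 <= S0 /\ forall s, S0 <= s ->
    0 < modsq s /\ wronskian s = W /\ W / 2 <= sqrt s * modsq s <= 2 * W /\
    modsq s / (4 * s) <= - dmodsq s.
Proof.
  generalize wronskian_pos. set (W := wronskian 0). intros HW.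
  (* The second entry makes [6 * (W + 2) / s] at most [W / 2]; the third, with 4608 = 2 * 48^2,
     yields [48 <= s * y]. *)
  exists W, (Rmax 2 (Rmax (12 * (W + 2) / W) (4608 / W))).
  split; auto. split. apply Rmax_l.
  intros s Hs.
  assert (s2 : 2 <= s) by (eapply Rle_trans; [apply Rmax_l | exact Hs]).
  assert (s3 : 12 * (W + 2) / W <= s).
  { eapply Rle_trans; [|exact Hs]. eapply Rle_trans; [|apply Rmax_r]. apply Rmax_l. }
  assert (s4 : 4608 / W <= s).
  { eapply Rle_trans; [|exact Hs]. eapply Rle_trans; [|apply Rmax_r]. apply Rmax_r. }
  apply Rmult_le_compat_r with (r := W) in s3, s4; try lra.
  unfold Rdiv in s3, s4. rewrite Rmult_assoc, Rinv_l, Rmult_1_r in s3, s4 by lra.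
  generalize (wronskian_approx s s2) (dmodsq_approx s s2).
  rewrite wronskian_const by lra. fold W. intros A D.
  apply Rabs_le_between in A, D.
  assert (yy : sqrt (modsq s) * sqrt (modsq s) = modsq s) by apply sqrt_sqrt, modsq_nonneg.
  assert (qq : sqrt s * sqrt s = s) by (apply sqrt_sqrt; lra).
  assert (q1 : 1 <= sqrt s) by (rewrite <- sqrt_1; apply sqrt_le_1_alt; lra).
  generalize (sqrt_pos (modsq s)). intros y0.
  set (y := sqrt (modsq s)) in *. set (q := sqrt s) in *. set (w := modsq s) in *.
  assert (is1 : 0 < / s <= / 2).
  { split. apply Rinv_0_lt_compat; lra. apply Rinv_le_contravar; lra. }
  assert (ss : s * / s = 1) by (field; lra).
  replace (/ s ^ 2) with (/ s * / s) in * by (field; lra).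
  unfold Rdiv in A, D.
  replace (/ s ^ 2) with (/ s * / s) in A, D by (field; lra).
  (* For [y > W + 2] the chain [y * y <= q * w <= W + 6 * y / s ^ 2 <= W + 3 / 2 * y] fails. *)
  assert (By : y <= W + 2).
  { apply Rnot_lt_le. intros Hy.
    assert (/ s * / s <= / 4) by nra.
    assert (6 * y * (/ s * / s) <= 6 * y * / 4) by (apply Rmult_le_compat_l; lra).
    assert (y * y <= q * w) by (rewrite <- yy; nra).
    assert (y * y >= (W + 2) * y) by nra. nra. }
  assert (B2 : 6 * y * (/ s * / s) <= W / 2).
  { apply Rle_trans with (6 * (W + 2) * / s).
    - replace (6 * y * (/ s * / s)) with ((6 * y) * / s * / s) by ring.
      assert (0 <= 6 * y * / s) by nra.
      apply Rle_trans with (6 * y * / s). nra. apply Rmult_le_compat_r; lra.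
    - apply Rmult_le_reg_r with s. lra. rewrite Rmult_assoc, Rinv_l by lra. lra. }
  assert (B3 : W / 2 <= q * w <= 2 * W) by lra.
  assert (w0 : 0 < w) by nra.
  split; auto. split. reflexivity. split. auto.
  assert (yp : 0 < y) by nra.
  (* As [q <= s], the square of [s * y] is [s * (s * w) >= s * (q * w) >= s * W / 2]. *)
  assert (sy : 48 <= s * y).
  { apply Rnot_lt_le. intros Hc.
    assert (X : s * y * (s * y) < 48 * 48) by (apply Rmult_le_0_lt_compat; nra).
    assert (q <= s) by nra.
    assert (s * (q * w) <= s * (s * w)) by (apply Rmult_le_compat_l; nra).
    assert (s * (W / 2) <= s * (q * w)) by (apply Rmult_le_compat_l; lra).
    replace (s * y * (s * y)) with (s * (s * w)) in X by (rewrite <- yy; ring).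
    lra. }
  assert (12 * y * (/ s * / s) <= w * / (4 * s)).
  { rewrite Rinv_mult, <- yy.
    replace (y * y * (/ 4 * / s)) with ((s * y) * (y * / 4 * / s * / s)) by (field; lra).
    replace (12 * y * (/ s * / s)) with (48 * (y * / 4 * / s * / s)) by (field; lra).
    apply Rmult_le_compat_r; auto.
    assert (0 < y * / 4 * / s) by (apply Rmult_lt_0_compat; lra). nra. }
  replace (w * / (2 * s)) with (w * / (4 * s) + w * / (4 * s)) in D by (field; lra).
  unfold Rdiv. lra.
Qed.

(** * The phase *)

Lemma is_derive_scal_r (f : R -> R) (x k df : R) :
  is_derive f x df -> is_derive (fun x => f x * k) x (df * k).
Proof.
  intros Hf. replace (df * k) with (df * k + f x * 0) by ring.
  apply (is_derive_mulR f (fun _ => k)); auto. apply (is_derive_const (V := R_NormedModule)).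
Qed.

(** The angle is only known to be continuous. After rotation by [- gam x] the point [(p, r)] lies in
    the right half plane near [x], and continuity keeps [gam - g] within a quarter turn, so locally
    [gam = g + atan (r / p)], which is differentiable. *)
Lemma is_derive_polar_angle (a b m gam : R -> R) (x a' b' : R) :
  continuous gam x ->
  (forall y, a y = m y * cos (gam y)) -> (forall y, b y = m y * sin (gam y)) ->
  0 < m x -> is_derive a x a' -> is_derive b x b' ->
  is_derive gam x ((a x * b' - b x * a') / (a x ^ 2 + b x ^ 2)).
Proof.
  intros Cg Ha Hb Hm Da Db.
  set (g := gam x).
  set (p := fun y => a y * cos g + b y * sin g).
  set (r := fun y => b y * cos g - a y * sin g).
  assert (Dp : is_derive p x (a' * cos g + b' * sin g)).
  { apply (is_derive_plus (fun y => a y * cos g) (fun y => b y * sin g));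
    now apply is_derive_scal_r. }
  assert (Dr : is_derive r x (b' * cos g - a' * sin g)).
  { apply (is_derive_minus (fun y => b y * cos g) (fun y => a y * sin g));
    now apply is_derive_scal_r. }
  assert (sc : sin g * sin g + cos g * cos g = 1) by apply sin2_cos2.
  assert (px : p x = m x).
  { unfold p. rewrite Ha, Hb. fold g.
    replace (m x) with (m x * (sin g * sin g + cos g * cos g)) at 3 by (rewrite sc; ring). ring. }
  assert (rx : r x = 0) by (unfold r; rewrite Ha, Hb; fold g; ring).
  assert (Pe : forall y, p y = m y * cos (gam y - g)).
  { intros y. unfold p. rewrite Ha, Hb, cos_minus. ring. }
  assert (Re : forall y, r y = m y * sin (gam y - g)).
  { intros y. unfold r. rewrite Ha, Hb, sin_minus. ring. }
  assert (Dat : is_derive (fun y => g + atan (r y * / p y)) x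
     ((b' * cos g - a' * sin g) / m x)).
  { replace ((b' * cos g - a' * sin g) / m x) with
      (0 + ((b' * cos g - a' * sin g) * / p x +
         r x * (- (a' * cos g + b' * sin g) / p x ^ 2)) * / (1 + (r x * / p x) ^ 2)).
    2: { rewrite px, rx. field. lra. }
    apply (is_derive_plus (fun _ => g) (fun y => atan (r y * / p y))).
    apply (is_derive_const (V := R_NormedModule)).
    apply (is_derive_comp (K := R_AbsRing) (V := R_NormedModule) atan (fun y => r y * / p y)).
    apply is_derive_Reals, derivable_pt_lim_atan.
    apply (is_derive_mulR r (fun y => / p y)); auto. apply (is_derive_inv p); auto. rewrite px; lra. }
  replace ((a x * b' - b x * a') / (a x ^ 2 + b x ^ 2)) with ((b' * cos g - a' * sin g) / m x).
  2: { rewrite Ha, Hb. fold g.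
       replace ((m x * cos g) ^ 2 + (m x * sin g) ^ 2) with
         (m x * m x * (sin g * sin g + cos g * cos g)) by ring.
       rewrite sc. field. lra. }
  apply (is_derive_ext_loc (fun y => g + atan (r y * / p y))); auto.
  assert (L1 : locally x (fun y => 0 < p y)).
  { assert (Cp := is_derive_continuous _ _ _ Dp).
    apply (Cp (fun z => 0 < z)). apply (open_gt 0). rewrite px. exact Hm. }
  assert (L2 : locally x (fun y => - (PI / 2) < gam y - g < PI / 2)).
  { apply (Cg (fun z => - (PI / 2) < z - g < PI / 2)).
    exists (mkposreal (PI / 2) PI2_RGT_0). intros z Hz.
    unfold ball in Hz; simpl in Hz; unfold AbsRing_ball, abs, minus, plus, opp in Hz; simpl in Hz.
    apply Rabs_def2 in Hz. fold g in Hz. lra. }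
  generalize (filter_and _ _ L1 L2). apply filter_imp. intros y [Hp Hy].
  rewrite Pe in Hp. rewrite Pe, Re.
  assert (0 < cos (gam y - g)) by (apply cos_gt_0; lra).
  assert (m y <> 0) by (intros E; rewrite E in Hp; lra).
  replace (m y * sin (gam y - g) * / (m y * cos (gam y - g))) with (tan (gam y - g)).
  - rewrite atan_tan by lra. eqR. ring.
  - unfold tan. field. split; lra.
Qed.

(** For large x, zeta is a positive multiple of Z at [k * (x + E / F)], where [k ^ 3 = F]. The
    effects of W and E are absorbed by [x0], so the two inequalities involve F alone. *)
Lemma phase_regularity (F E : R) (gam : R -> R) : 0 < F -> is_phase F E gam ->
  exists x0, 0 < x0 /\ exists gam2 : R -> R, forall x, x0 <= x ->
    is_derive gam x (Derive gam x) /\ 0 < Derive gam x /\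
    is_derive (Derive gam) x (gam2 x) /\
    F / 16 <= gam2 x * Derive gam x /\ Derive gam x ^ 2 <= 8 * F * x.
Proof.
  intros HF [Cg [Hz _]].
  set (k := Rpower F (1 / 3)).
  assert (k0 : 0 < k) by apply exp_pos.
  assert (k3 : k ^ 3 = F).
  { unfold k. rewrite <- Rpower_pow by apply exp_pos. rewrite Rpower_mult.
    replace (1 / 3 * INR 3) with 1 by (simpl; field). now apply Rpower_1. }
  destruct modsq_asymptotics as [W [S0 [HW [HS0 MA]]]].
  set (s := fun x => k * (x + E / F)).
  assert (Ds : forall x, is_derive s x k).
  { intros x. unfold s. auto_derive; trivial. ring. }
  set (c := sqrt (PI / k) * / PI).
  assert (c0 : 0 < c).
  { generalize PI_RGT_0; intros. unfold c. apply Rmult_lt_0_compat.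
    apply sqrt_lt_R0, Rdiv_lt_0_compat; auto. now apply Rinv_0_lt_compat. }
  set (a := fun x => fst (zeta F E x)). set (b := fun x => snd (zeta F E x)).
  assert (ab : forall x, 0 <= s x -> a x = c * piBi (s x) /\ b x = c * piAi (s x)).
  { intros x Hx. unfold a, b, zeta. simpl. fold k.
    replace (- k * (x + E / F)) with (- s x) by (unfold s; ring).
    rewrite Bi_opp, Ai_opp by auto. unfold c. split; ring. }
  assert (Dgam : forall x, S0 < s x -> is_derive gam x (k * W / modsq (s x))).
  { intros x Hx. destruct (MA (s x) ltac:(lra)) as [w0 [wW _]].
    destruct (ab x ltac:(lra)) as [ax bx].
    assert (Lx : locally x (fun y => 0 <= s y)).
    { assert (Cs := is_derive_continuous _ _ _ (Ds x)).
      apply (Cs (fun z => 0 <= z)). apply filter_imp with (fun z => 0 < z).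
      intros; lra. apply (open_gt 0). simpl. lra. }
    replace (k * W / modsq (s x)) with
      ((a x * (c * (k * dpiAi (s x))) - b x * (c * (k * dpiBi (s x)))) / (a x ^ 2 + b x ^ 2)).
    2: { rewrite ax, bx, <- wW.
         replace ((c * piBi (s x)) ^ 2 + (c * piAi (s x)) ^ 2) with (c * c * modsq (s x))
           by (unfold modsq; ring).
         replace (c * piBi (s x) * (c * (k * dpiAi (s x))) - c * piAi (s x) * (c * (k * dpiBi (s x))))
           with (c * c * (k * wronskian (s x))) by (unfold wronskian; ring).
         field. lra. }
    apply (is_derive_polar_angle a b (fun x => Cmod (zeta F E x))).
    - apply Cg.
    - intros y. unfold a. rewrite Hz at 1. reflexivity.
    - intros y. unfold b. rewrite Hz at 1. reflexivity.
    - apply Cmod_gt_0. intros Z. unfold a, b in *. rewrite Z in ax, bx. simpl in ax, bx.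

      assert (U0 : piBi (s x) = 0) by (apply Rmult_eq_reg_l with c; lra).
      assert (V0 : piAi (s x) = 0) by (apply Rmult_eq_reg_l with c; lra).
      unfold modsq in w0. rewrite U0, V0 in w0. lra.
    - apply (is_derive_ext_loc (fun y => c * piBi (s y))).
      + revert Lx. apply filter_imp. intros y Hy. exact (eq_sym (proj1 (ab y Hy))).
      + apply is_derive_scal.
        apply (is_derive_comp (K := R_AbsRing) (V := R_NormedModule) piBi s); auto.
        apply is_derive_piBi. lra.
    - apply (is_derive_ext_loc (fun y => c * piAi (s y))).
      + revert Lx. apply filter_imp. intros y Hy. exact (eq_sym (proj2 (ab y Hy))).
      + apply is_derive_scal.
        apply (is_derive_comp (K := R_AbsRing) (V := R_NormedModule) piAi s); auto.
        apply is_derive_piAi. lra. }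
  (* The entries ensure [1 <= x], then [x + E / F <= 2 * x], then [S0 < s x]. *)
  exists (Rmax 1 (Rmax (Rabs E / F) ((S0 + 1) / k - E / F))).
  split. eapply Rlt_le_trans; [|apply Rmax_l]. lra.
  exists (fun x => k * W * (- (k * dmodsq (s x)) / modsq (s x) ^ 2)).
  intros x Hx.
  assert (X1 : 1 <= x) by (eapply Rle_trans; [apply Rmax_l|exact Hx]).
  assert (X2 : Rabs E / F <= x).
  { eapply Rle_trans; [|exact Hx]. eapply Rle_trans; [|apply Rmax_r]. apply Rmax_l. }
  assert (X3 : S0 < s x).
  { assert ((S0 + 1) / k - E / F <= x).
    { eapply Rle_trans; [|exact Hx]. eapply Rle_trans; [|apply Rmax_r]. apply Rmax_r. }
    unfold s. assert (k * ((S0 + 1) / k) <= k * (x + E / F)) by (apply Rmult_le_compat_l; lra).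
    replace (k * ((S0 + 1) / k)) with (S0 + 1) in * by (field; lra). lra. }
  assert (De := is_derive_unique _ _ _ (Dgam x X3)).
  destruct (MA (s x) ltac:(lra)) as [w0 [_ [wB wD]]].
  split. rewrite De. now apply Dgam.
  assert (kWw : 0 < k * W / modsq (s x)).
  { apply Rdiv_lt_0_compat; auto. now apply Rmult_lt_0_compat. }
  split. now rewrite De. split.
  - apply (is_derive_ext_loc (fun y => k * W * / modsq (s y))).
    + assert (Lx : locally x (fun y => S0 < s y)).
      { assert (Cs := is_derive_continuous _ _ _ (Ds x)).
        apply (Cs (fun z => S0 < z)). now apply (open_gt S0). }
      revert Lx. apply filter_imp. intros y Hy. symmetry. apply is_derive_unique. now apply Dgam.
    + apply is_derive_scal. apply (is_derive_inv (fun y => modsq (s y))). 2: lra.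
      apply (is_derive_comp (K := R_AbsRing) (V := R_NormedModule) modsq s); auto.
      apply is_derive_modsq. lra.
  - rewrite De.
    assert (qq : sqrt (s x) * sqrt (s x) = s x) by (apply sqrt_sqrt; lra).
    assert (q0 : 0 < sqrt (s x)) by (apply sqrt_lt_R0; lra).
    set (w := modsq (s x)) in *. set (q := sqrt (s x)) in *.
    assert (iw : 0 < / w) by now apply Rinv_0_lt_compat.
    (* [W / w] is within a factor 2 of [q], whatever W is. With gam' = k v, F / 16 is a quarter from
       [v * v] times a quarter from [modsq_asymptotics]; 8 F is 4 from [v * v] times 2 from
       [x + E / F <= 2 * x]. *)
    assert (Ww : q / 2 <= W * / w <= 2 * q).
    { split; apply Rmult_le_reg_r with w; auto; rewrite Rmult_assoc, Rinv_l by lra; lra. }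
    set (v := W * / w) in *.
    assert (v2 : q * q / 4 <= v * v <= 4 * (q * q)) by (split; nra).
    split.
    + apply Rle_trans with (k ^ 3 * (v * v) * / (4 * s x)).
      * rewrite k3. apply Rle_trans with (F * (q * q / 4) * / (4 * s x)).
        rewrite qq. apply Req_le. field. lra.
        apply Rmult_le_compat_r. apply Rlt_le, Rinv_0_lt_compat; lra.
        apply Rmult_le_compat_l; lra.
      * replace (k * W * (- (k * dmodsq (s x)) / w ^ 2) * (k * W / w)) with
          (k ^ 3 * (v * v) * (- dmodsq (s x) * / w)) by (unfold v; field; lra).
        apply Rmult_le_compat_l. apply Rmult_le_pos. apply pow_le; lra. nra.
        apply Rmult_le_reg_r with w; auto. rewrite Rmult_assoc, Rinv_l by lra.
        unfold Rdiv in wD. lra.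
    + replace ((k * W / w) ^ 2) with (k ^ 2 * (v * v)) by (unfold v; field; lra).
      apply Rle_trans with (k ^ 2 * (4 * (q * q))).
      apply Rmult_le_compat_l. apply pow_le; lra. lra.
      rewrite qq. unfold s.
      replace (k ^ 2 * (4 * (k * (x + E / F)))) with (4 * k ^ 3 * (x + E / F)) by ring.
      rewrite k3. replace (8 * F * x) with (4 * F * (x + x)) by ring.
      apply Rmult_le_compat_l. lra.
      assert (E / F <= Rabs E / F).
      { apply Rmult_le_compat_r. apply Rlt_le, Rinv_0_lt_compat; lra. apply Rle_abs. }
      lra.
Qed.

(** * Exponential sums *)

Definition csum (f : nat -> Complex.C) (m N : nat) : Complex.C :=
  fold_right Cplus (RtoC 0) (map f (seq m N)).

Lemma csum_S (f : nat -> Complex.C) (m N : nat) :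
  csum f m (S N) = Cplus (csum f m N) (f (m + N)%nat).
Proof.
  unfold csum. rewrite seq_S, map_app, fold_right_app. simpl.
  induction (map f (seq m N)) as [|z s IH]; simpl.
  - ring.
  - rewrite IH. ring.
Qed.

Lemma filter_all {A : Type} (p : A -> bool) (s : list A) :
  (forall x, In x s -> p x = true) -> filter p s = s.
Proof.
  induction s as [|x s IH]; simpl; intros Hp; auto.
  rewrite Hp by auto. f_equal. auto.
Qed.

Lemma filter_none {A : Type} (p : A -> bool) (s : list A) :
  (forall x, In x s -> p x = false) -> filter p s = nil.
Proof.
  induction s as [|x s IH]; simpl; intros Hp; auto.
  rewrite Hp by auto. auto.
Qed.

Lemma sum_range_csum (a b : R) (f : nat -> Complex.C) : 0 <= a -> a < b ->
  exists m N, sum_range a b f = csum f m N /\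
    (forall n, (m <= n < m + N)%nat -> a < INR n <= b).
Proof.
  intros Ha Hab.
  destruct (archimed a) as [a1 a2]. destruct (archimed b) as [b1 b2].
  assert (0 < up a)%Z by (apply lt_IZR; lra).
  assert (up a <= up b)%Z.
  { apply Z.lt_succ_r. apply lt_IZR. rewrite succ_IZR. lra. }
  (* [up a] and [up b] are the first integers beyond [a] and [b], which matches the range open at
     [a] and closed at [b]. As [0 <= a], [up a] is positive and [Z.to_nat] is faithful. *)
  exists (Z.to_nat (up a)), (Z.to_nat (up b) - Z.to_nat (up a))%nat.
  set (m := Z.to_nat (up a)). set (N := (Z.to_nat (up b) - m)%nat).
  assert (EN : Z.to_nat (up b) = (m + N)%nat) by (unfold N, m; lia).
  assert (R1 : forall n, (m <= n < m + N)%nat -> a < INR n <= b).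
  { intros n Hn. rewrite INR_IZR_INZ.
    assert (IZR (up a) <= IZR (Z.of_nat n)) by (apply IZR_le; lia).
    assert (IZR (Z.of_nat n) <= IZR (up b - 1)) by (apply IZR_le; lia).
    rewrite minus_IZR in H2. lra. }
  split; auto.
  unfold sum_range, csum. rewrite EN, seq_app, filter_app.
  rewrite filter_none, filter_all; auto.
  - intros n Hn. apply in_seq in Hn. destruct (R1 n) as [r1 r2]. lia.
    destruct (Rlt_dec a (INR n)); try lra. destruct (Rle_dec (INR n) b); try lra.
  - intros n Hn. apply in_seq in Hn.
    assert (INR n <= a).
    { rewrite INR_IZR_INZ. assert (IZR (Z.of_nat n) <= IZR (up a - 1)) by (apply IZR_le; lia).
      rewrite minus_IZR in H1. lra. }
    destruct (Rlt_dec a (INR n)); try lra; auto.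
Qed.

Definition expi (t : R) : Complex.C := (cos t, sin t).

Lemma Cmod_expi (t : R) : Cmod (expi t) = 1.
Proof.
  unfold Cmod, expi. simpl. transitivity (sqrt 1); [f_equal | apply sqrt_1].
  generalize (sin2_cos2 t). unfold Rsqr. lra.
Qed.

Lemma expi_add (s t : R) : expi (s + t) = Cmult (expi s) (expi t).
Proof. unfold expi, Cmult; simpl. rewrite cos_plus, sin_plus. f_equal; ring. Qed.

Lemma abs_sin_le (x : R) : Rabs (sin x) <= Rabs x.
Proof.
  assert (P : forall y, 0 < y -> Rabs (sin y) <= y).
  { intros y Hy. apply Rabs_le. split. 2: apply Rlt_le, sin_lt_x, Hy.
    destruct (Rle_dec y PI) as [h|h].
    - generalize (sin_ge_0 y ltac:(lra) h). lra.
    - generalize PI2_3_2 (SIN_bound y). lra. }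
  destruct (total_order_T x 0) as [[h| ->]|h].
  - rewrite <- (Rabs_Ropp (sin x)), <- sin_neg, (Rabs_left x) by auto. apply P. lra.
  - rewrite sin_0, Rabs_R0. lra.
  - rewrite (Rabs_pos_eq x) by lra. auto.
Qed.

Lemma Cmod_expi_sub (s t : R) : Cmod (Cminus (expi s) (expi t)) <= Rabs (s - t).
Proof.
  rewrite <- sqrt_Rsqr_abs. unfold Cmod. apply sqrt_le_1_alt. unfold expi; simpl.
  replace ((cos s + - cos t) * ((cos s + - cos t) * 1) +
           (sin s + - sin t) * ((sin s + - sin t) * 1))
    with (2 * (1 - cos (s - t))).
  2: { rewrite cos_minus. generalize (sin2_cos2 s) (sin2_cos2 t). unfold Rsqr. nra. }
  replace (s - t) with (2 * ((s - t) / 2)) at 1 by field.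
  rewrite cos_2a_sin.
  generalize (abs_sin_le ((s - t) / 2)). intros A.
  apply Rsqr_le_abs_1 in A. unfold Rsqr in *. nra.
Qed.

(* [1 / (1 - e^(2 i psi)) = 1/2 + (i/2) cot psi]. *)
Definition cotc (psi : R) : Complex.C := (1 / 2, cos psi / sin psi / 2).

Lemma expi_telescope (t psi : R) : sin psi <> 0 ->
  expi t = Cmult (cotc psi) (Cminus (expi t) (expi (t + 2 * psi))).
Proof.
  intros Hs. rewrite expi_add.
  unfold expi, cotc, Cmult, Cminus, Cplus, Copp; simpl.
  rewrite cos_2a, sin_2a.
  assert (E : cos psi * cos psi = 1 - sin psi * sin psi).
  { generalize (sin2_cos2 psi). unfold Rsqr. lra. }
  f_equal.
  - rewrite E. transitivity (cos t * (sin psi * sin psi + cos psi * cos psi)).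
    rewrite E. ring. field_simplify; auto.
    replace (cos psi ^ 2) with (1 - sin psi ^ 2) by (simpl; lra). field. auto.
  - rewrite E. field_simplify; auto.
    replace (cos psi ^ 2) with (1 - sin psi ^ 2) by (simpl; lra). field. auto.
Qed.

(** The variation of [g] is measured by the drop of a potential [v], so several monotone quantities
    combine into one telescoping bound. Including the boundary term at [m + N] makes the inequality
    inductive. *)
Lemma abel_summation (fe e g : nat -> Complex.C) (v : nat -> R) (m N : nat) :
  (forall n, (m <= n < m + N)%nat -> fe n = Cmult (g n) (Cminus (e n) (e (S n)))) ->
  (forall n, Cmod (e n) <= 1) ->
  (forall n, (m <= n < m + N)%nat -> Cmod (Cminus (g (S n)) (g n)) <= v n - v (S n)) ->
  Cmod (Cplus (csum fe m N) (Cmult (g (m + N)%nat) (e (m + N)%nat)))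
    <= Cmod (g m) + v m - v (m + N)%nat.
Proof.
  intros Hfe He. induction N as [|N IH]; intros Hg.
  - rewrite Nat.add_0_r. unfold csum; simpl. rewrite Cplus_0_l, Cmod_mult.
    generalize (He m) (Cmod_ge_0 (g m)). nra.
  - rewrite csum_S, <- plus_n_Sm.
    set (n := (m + N)%nat) in *.
    replace (Cplus (Cplus (csum fe m N) (fe n)) (Cmult (g (S n)) (e (S n)))) with
      (Cplus (Cplus (csum fe m N) (Cmult (g n) (e n)))
             (Cmult (Cminus (g (S n)) (g n)) (e (S n)))).
    2: { rewrite (Hfe n) by (unfold n; lia). ring. }
    eapply Rle_trans. apply Cmod_triangle. rewrite Cmod_mult.
    assert (Cmod (Cplus (csum fe m N) (Cmult (g n) (e n))) <= Cmod (g m) + v m - v n).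
    { apply IH; intros; [apply Hfe | apply Hg]; lia. }
    generalize (Hg n ltac:(unfold n; lia)) (He (S n))
      (Cmod_ge_0 (Cminus (g (S n)) (g n))) (Cmod_ge_0 (e (S n))). nra.
Qed.

(** * Sine and cotangent away from the multiples of PI *)

Lemma sin_ge_half (d : R) : 0 < d <= 1 -> d / 2 <= sin d.
Proof.
  intros Hd. generalize PI2_3_2. intros.
  destruct (MVT_cor2 sin cos 0 d) as [c [Ec Hc]]. lra.
  intros; apply derivable_pt_lim_sin.
  assert (1 / 2 <= cos c) by (rewrite <- cos_PI3; apply cos_decr_1; lra).
  rewrite sin_0 in Ec. nra.
Qed.

Lemma sin_ge_sin (d x : R) : 0 <= d -> d <= x <= PI - d -> sin d <= sin x.
Proof.
  intros Hd Hx. generalize (form4 x d). intros E.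
  assert (0 <= cos ((x + d) / 2)) by (apply cos_ge_0; lra).
  assert (0 <= sin ((x - d) / 2)) by (apply sin_ge_0; lra). nra.
Qed.

Lemma cos_sin_INR_PI (l : nat) (x : R) :
  cos (x + PI * INR l) = (-1) ^ l * cos x /\ sin (x + PI * INR l) = (-1) ^ l * sin x.
Proof.
  induction l as [|l [IHc IHs]].
  - simpl. rewrite Rmult_0_r, Rplus_0_r. lra.
  - rewrite S_INR. replace (x + PI * (INR l + 1)) with (x + PI * INR l + PI) by ring.
    rewrite neg_cos, neg_sin, IHc, IHs. simpl. lra.
Qed.

Definition cot (x : R) : R := cos x / sin x.

Lemma pow_m1_neq_0 (l : nat) : (-1) ^ l <> 0.
Proof. apply pow_nonzero. lra. Qed.

Lemma cot_INR_PI (l : nat) (x : R) : sin x <> 0 -> cot (x + PI * INR l) = cot x.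
Proof.
  intros Hx. unfold cot. destruct (cos_sin_INR_PI l x) as [-> ->].
  field. split; auto. apply pow_m1_neq_0.
Qed.

Lemma cot_bound (d : R) (l : nat) (x : R) : 0 < d <= 1 ->
  PI * INR l + d <= x <= PI * INR (S l) - d -> sin x <> 0 /\ Rabs (cot x) <= 2 / d.
Proof.
  intros Hd Hx. rewrite S_INR in Hx.
  set (y := x - PI * INR l).
  assert (Hy : sin d <= sin y) by (apply sin_ge_sin; unfold y; lra).
  generalize (sin_ge_half d Hd). intros Hs.
  assert (sin x <> 0).
  { replace x with (y + PI * INR l) by (unfold y; ring).
    rewrite (proj2 (cos_sin_INR_PI l y)). apply Rmult_integral_contrapositive.
    split. apply pow_m1_neq_0. lra. }
  split; auto.
  replace x with (y + PI * INR l) by (unfold y; ring).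
  rewrite cot_INR_PI by lra. unfold cot, Rdiv. rewrite Rabs_mult.
  rewrite (Rabs_pos_eq (/ sin y)) by (apply Rlt_le, Rinv_0_lt_compat; lra).
  assert (Rabs (cos y) <= 1) by (apply Rabs_le, COS_bound).
  replace (2 * / d) with (1 * / (d / 2)) by (field; lra).
  apply Rmult_le_compat; auto using Rabs_pos. apply Rlt_le, Rinv_0_lt_compat; lra.
  apply Rinv_le_contravar; lra.
Qed.

(** Within one period, cot u - cot v = sin (v - u) / (sin u sin v), and none of the three sines is
    negative. *)
Lemma cot_decreasing (d : R) (l : nat) (x y : R) : 0 < d <= 1 ->
  PI * INR l + d <= x -> x <= y -> y <= PI * INR (S l) - d -> cot y <= cot x.
Proof.
  intros Hd Hx Hxy Hy. rewrite S_INR in Hy.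
  generalize (sin_ge_half d Hd). intros Hs.
  set (u := x - PI * INR l). set (v := y - PI * INR l).
  assert (sin d <= sin u) by (apply sin_ge_sin; unfold u; lra).
  assert (sin d <= sin v) by (apply sin_ge_sin; unfold v; lra).
  replace x with (u + PI * INR l) by (unfold u; ring).
  replace y with (v + PI * INR l) by (unfold v; ring).
  rewrite !cot_INR_PI by lra.
  assert (0 <= sin (v - u)) by (apply sin_ge_0; unfold u, v; lra).
  rewrite sin_minus in *. unfold cot.
  assert (0 <= cos u / sin u - cos v / sin v); [|lra].
  replace (cos u / sin u - cos v / sin v) with
    ((sin v * cos u - cos v * sin u) * / (sin u * sin v)) by (field; lra).
  apply Rmult_le_pos; auto. apply Rlt_le, Rinv_0_lt_compat. nra.
Qed.

Lemma Cmod_pair_le (x y : R) : Cmod (x, y) <= Rabs x + Rabs y.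
Proof.
  replace ((x, y) : Complex.C) with (Cplus (x, 0) (0, y))
    by (unfold Cplus; simpl; f_equal; ring).
  eapply Rle_trans. apply Cmod_triangle. unfold Cmod; simpl.
  right. f_equal; rewrite <- sqrt_Rsqr_abs; f_equal; unfold Rsqr; ring.
Qed.

(* The factors [cotc (psi n)] have total variation O(1/d) because the cotangent is monotone
   between consecutive multiples of PI. *)
Lemma kuzmin_landau (Theta h rho : nat -> R) (m N l : nat) (d T eta : R) :
  let psi n := (Theta (S n) - Theta n) / 2 in
  0 < d <= 1 -> 0 <= T -> 0 <= eta ->
  (forall n, (m <= n)%nat -> (S n < m + N)%nat ->
     PI * INR l + d <= psi n <= PI * INR (S l) - d) ->
  (forall n, (m <= n)%nat -> (S (S n) < m + N)%nat -> psi n <= psi (S n)) ->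
  (forall n, (m <= n < m + N)%nat -> 0 <= rho n <= T) ->
  (forall n, (m <= n)%nat -> (S n < m + N)%nat -> rho (S n) <= rho n) ->
  (forall n, (m <= n)%nat -> (S n < m + N)%nat -> Rabs (h (S n) - h n) <= eta) ->
  Cmod (csum (fun n => Cmult (rho n) (expi (Theta n + h n))) m N)
    <= T * (2 / d) * (5 + eta * INR N).
Proof.
  intros psi Hd HT Heta Hpsi Mpsi Hrho Mrho Hh.
  set (B := 2 / d).
  assert (B1 : 2 <= B).
  { unfold B. apply Rmult_le_reg_r with d. lra. unfold Rdiv.
    rewrite Rmult_assoc, Rinv_l by lra. lra. }
  set (fe := fun n => Cmult (rho n) (expi (Theta n + h n))).
  assert (Hfe : forall n, (m <= n < m + N)%nat -> Cmod (fe n) <= T).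
  { intros n Hn. unfold fe. rewrite Cmod_mult, Cmod_expi, Cmod_R, Rmult_1_r.
    rewrite Rabs_pos_eq; apply Hrho; auto. }
  (* [psi n] is controlled only when both [n] and [S n] lie in the block. For [N = k + 2] the
     telescoping identity reaches [m + k], and the last term is bounded by [T]; shorter blocks are
     immediate. *)
  destruct N as [|[|k]].
  - unfold csum; simpl. rewrite Cmod_0. apply Rmult_le_pos; nra.
  - rewrite csum_S. unfold csum at 1; simpl. rewrite Cplus_0_l, Nat.add_0_r.
    eapply Rle_trans. apply Hfe; lia. rewrite <- (Rmult_1_r T) at 1.
    rewrite Rmult_assoc. apply Rmult_le_compat_l; nra.
  - set (f := fun n => Cmult (rho n) (expi (h n))).
    set (e := fun n => expi (Theta n)).
    set (g := fun n => Cmult (f n) (cotc (psi n))).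
    (* One summand per source of variation: the cotangent and [rho] decrease, and the linear term
       pays [B * T * eta] per step for [h]. *)
    set (v := fun n => T * cot (psi n) / 2 + B * rho n - B * T * eta * INR n).
    assert (Q : forall n, (m <= n <= m + k)%nat ->
       fe n = Cmult (g n) (Cminus (e n) (e (S n)))).
    { intros n Hn. unfold fe, g, f, e.
      replace (Theta (S n)) with (Theta n + 2 * psi n) by (unfold psi; field).
      rewrite <- Cmult_assoc, <- expi_telescope.
      rewrite expi_add. ring.
      apply (cot_bound d l); auto. apply Hpsi; lia. }
    assert (Hf : forall n, (m <= n < m + S (S k))%nat -> Cmod (f n) <= T).
    { intros n Hn. unfold f. rewrite Cmod_mult, Cmod_expi, Cmod_R, Rmult_1_r.
      rewrite Rabs_pos_eq; apply Hrho; auto. }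
    assert (Hcot : forall n, (m <= n <= m + k)%nat -> Rabs (cot (psi n)) <= B).
    { intros n Hn. apply (cot_bound d l); auto. apply Hpsi; lia. }
    assert (Hc : forall n, (m <= n <= m + k)%nat -> Cmod (cotc (psi n)) <= B).
    { intros n Hn. eapply Rle_trans. apply Cmod_pair_le.
      generalize (Hcot n Hn). unfold cot. intros C.
      rewrite (Rabs_pos_eq (1 / 2)) by lra. unfold Rdiv at 2. rewrite Rabs_mult.
      rewrite (Rabs_pos_eq (/ 2)) by lra. lra. }
    assert (Hg : forall n, (m <= n <= m + k)%nat -> Cmod (g n) <= T * B).
    { intros n Hn. unfold g. rewrite Cmod_mult.
      apply Rmult_le_compat; auto using Cmod_ge_0. apply Hf; lia. }
    assert (A := abel_summation fe e g v m k).
    assert (A' : Cmod (Cplus (csum fe m k) (Cmult (g (m + k)%nat) (e (m + k)%nat)))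
      <= Cmod (g m) + v m - v (m + k)%nat).
    { apply A; clear A.
      - intros n Hn. apply Q. lia.
      - intros n. unfold e. rewrite Cmod_expi. lra.
      - intros n Hn.
        replace (Cminus (g (S n)) (g n)) with
          (Cplus (Cmult (f (S n)) (Cminus (cotc (psi (S n))) (cotc (psi n))))
                 (Cmult (cotc (psi n))
                    (Cplus (Cmult (RtoC (rho (S n) - rho n)) (expi (h (S n))))
                           (Cmult (rho n) (Cminus (expi (h (S n))) (expi (h n))))))).
        2: { unfold g, f. rewrite RtoC_minus. ring. }
        assert (cot (psi (S n)) <= cot (psi n)).
        { apply (cot_decreasing d l); auto; try apply Hpsi; try apply Mpsi; lia. }
        assert (Cmod (Cminus (cotc (psi (S n))) (cotc (psi n))) <=
            (cot (psi n) - cot (psi (S n))) / 2).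
        { unfold cotc, Cminus, Cplus, Copp; simpl.
          eapply Rle_trans. apply Cmod_pair_le.
          rewrite Rplus_opp_r, Rabs_R0, Rplus_0_l.
          apply Rabs_le. unfold cot in *. lra. }
        assert (0 <= rho n <= T) by (apply Hrho; lia).
        assert (rho (S n) <= rho n) by (apply Mrho; lia).
        assert (Cmod (Cplus (Cmult (RtoC (rho (S n) - rho n)) (expi (h (S n))))
               (Cmult (rho n) (Cminus (expi (h (S n))) (expi (h n)))))
             <= (rho n - rho (S n)) + T * eta).
        { eapply Rle_trans. apply Cmod_triangle.
          rewrite !Cmod_mult, !Cmod_R, Cmod_expi, Rmult_1_r.
          apply Rplus_le_compat. rewrite Rabs_left1; lra.
          rewrite (Rabs_pos_eq (rho n)) by lra.
          apply Rmult_le_compat; try apply Cmod_ge_0; try lra.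
          eapply Rle_trans. apply Cmod_expi_sub. apply Hh; lia. }
        eapply Rle_trans. apply Cmod_triangle. rewrite !Cmod_mult.
        apply Rle_trans with (T * ((cot (psi n) - cot (psi (S n))) / 2) +
           B * ((rho n - rho (S n)) + T * eta)).
        + apply Rplus_le_compat; apply Rmult_le_compat; try apply Cmod_ge_0; auto.
          apply Hf; lia. apply Hc; lia.
        + unfold v. rewrite S_INR. right. field. }
    assert (E : csum fe m (S (S k)) = Cplus (Cplus (Cplus (csum fe m k)
        (Cmult (g (m + k)%nat) (e (m + k)%nat))) (Copp (Cmult (g (m + k)%nat) (e (S (m + k))))))
        (fe (S (m + k)))).
    { rewrite !csum_S, <- plus_n_Sm. rewrite (Q (m + k)%nat) by lia. ring. }
    rewrite E.
    eapply Rle_trans. apply Cmod_triangle.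
    eapply Rle_trans. apply Rplus_le_compat_r. apply Cmod_triangle.
    rewrite Cmod_opp, Cmod_mult. unfold e at 2. rewrite Cmod_expi.
    generalize (Hg m ltac:(lia)) (Hg (m + k)%nat ltac:(lia)) (Hfe (S (m + k)) ltac:(lia)).
    intros G1 G2 G3.
    generalize (Hcot m ltac:(lia)) (Hcot (m + k)%nat ltac:(lia)). intros C1 C2.
    apply Rabs_le_between in C1, C2.
    generalize (Hrho m ltac:(lia)) (Hrho (m + k)%nat ltac:(lia)). intros R1 R2.
    (* The 5 in the bound counts 2 here, from the cotangent and [rho], 2 for the boundary values of
       [g], and 1 for the last term. *)
    assert (VV : v m - v (m + k)%nat <= 2 * (T * B) + T * B * (eta * INR k)).
    { unfold v. rewrite plus_INR.
      assert (T * cot (psi m) <= T * B) by (apply Rmult_le_compat_l; lra).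
      assert (T * - B <= T * cot (psi (m + k)%nat)) by (apply Rmult_le_compat_l; lra).
      assert (B * rho m <= B * T) by (apply Rmult_le_compat_l; lra).
      assert (0 <= B * rho (m + k)%nat) by (apply Rmult_le_pos; lra). nra. }
    assert (T * B * (eta * INR k) <= T * B * (eta * INR (S (S k)))).
    { apply Rmult_le_compat_l. apply Rmult_le_pos; lra. apply Rmult_le_compat_l; auto.
      apply le_INR. lia. }
    assert (T <= T * B) by nra. lra.
Qed.

(** * The sum over one block *)

(** For gam' of order sqrt x the derivative gam'' tends to 0, but gam'' gam' does not; the square
    therefore grows linearly. *)
Lemma sqr_growth (d d' : R -> R) (x0 c u v : R) :
  (forall x, x0 <= x -> is_derive d x (d' x) /\ c <= d' x * d x) ->
  x0 <= u <= v -> 2 * c * (v - u) <= d v ^ 2 - d u ^ 2.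
Proof.
  intros Hd Huv.
  destruct (MVT_gen (fun x => d x * d x) u v (fun x => d' x * d x + d x * d' x))
    as [z [Hz Ez]].
  - intros x. rewrite Rmin_left, Rmax_right by lra. intros Hx.
    apply (is_derive_mulR d d); apply Hd; lra.
  - intros x. rewrite Rmin_left, Rmax_right by lra. intros Hx.
    apply continuity_pt_filterlim.
    apply (is_derive_continuous (fun x => d x * d x) x (d' x * d x + d x * d' x)).
    apply (is_derive_mulR d d); apply Hd; lra.
  - rewrite Rmin_left, Rmax_right in Hz by lra.
    destruct (Hd z ltac:(lra)) as [_ Hc].
    replace (d v ^ 2 - d u ^ 2) with (d v * d v - d u * d u) by ring. rewrite Ez.
    apply Rmult_le_compat_r; lra.
Qed.

Lemma Rpower_opp_le (x y r : R) : 0 <= r -> 0 < x <= y -> Rpower y (- r) <= Rpower x (- r).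
Proof.
  intros Hr Hxy. rewrite !Rpower_Ropp. apply Rinv_le_contravar. apply exp_pos.
  now apply Rle_Rpower_l.
Qed.

(* [X_l] and [X_{l+1}] enter only through the values [PI l] and [PI (l+1)] of [d = gam']. *)
Lemma phase_sum_bound (F1 F2 B2 C1 C2 F alpha beta sigma Cc x0 Xl Xl1 a b : R)
    (gam d d' : R -> R) (h : nat -> R) (l : nat) :
  0 < F1 -> 0 < C1 -> F1 <= F <= F2 -> 0 <= alpha -> 0 < beta <= B2 -> sigma <= 1 ->
  C1 <= Cc <= C2 -> 0 < x0 -> (1 <= l)%nat ->
  (forall x, x0 <= x -> is_derive gam x (d x) /\ 0 < d x /\ is_derive d x (d' x) /\
     F / 16 <= d' x * d x /\ d x ^ 2 <= 8 * F * x) ->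
  x0 <= Xl -> x0 <= Xl1 -> d Xl = PI * INR l -> d Xl1 = PI * INR (S l) ->
  (forall n : nat, Xl <= INR n <= Xl1 ->
       Rabs (h (S n) - h n) <= Cc * Rpower (INR n) (- beta)) ->
  Xl + Cc * Rpower (INR l) sigma <= a -> a < b ->
  b <= Xl1 - Cc * Rpower (INR l) sigma ->
  Cmod (sum_range a b (fun n => Cmult (RtoC (/ Rpower (d (INR n)) alpha)%R)
          (expi (2 * gam (INR n) + h n))))
  <= 2 / Rmin 1 (F1 * C1 / 128) * (5 + C2 * Rpower (Rmax 1 F2) B2 * (384 / F1 + 1)) *
     (Rpower (INR l) (- alpha - sigma + 1) * (1 + Rpower (INR l) (1 - 2 * beta))).
Proof.
  intros HF1 HC1 HF Hal Hbe Hsi HCc Hx0 Hl Hreg HXl HXl1 dXl dXl1 Hh Ha Hab Hb.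
  set (L := INR l) in *.
  assert (L1 : 1 <= L) by (apply (le_INR 1), Hl).
  rewrite S_INR in dXl1. fold L in dXl1.
  generalize PI2_3_2 PI_4. intros Pi3 Pi4.
  assert (Pls : 0 < Rpower L sigma) by apply exp_pos.
  assert (CP : 0 < Cc * Rpower L sigma) by nra.
  (* 128 = 8 * 16: [d ^ 2] grows at rate F / 8, and [d v + d u <= 16 * L] on the block. The minimum
     with 1 gives [delta <= 1], required by [kuzmin_landau]. *)
  set (c0 := Rmin 1 (F1 * C1 / 128)).
  assert (c0p : 0 < c0) by (apply Rmin_pos; nra).
  assert (c01 : c0 <= 1) by apply Rmin_l.
  assert (c02 : c0 <= F1 * C1 / 128) by apply Rmin_r.
  set (delta := c0 * Rpower L (sigma - 1)).
  assert (Pls1 : 0 < Rpower L (sigma - 1) <= 1).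
  { split. apply exp_pos. apply Rle_trans with (Rpower L 0).
    apply Rle_Rpower; lra. rewrite Rpower_O; lra. }
  assert (Els : L * Rpower L (sigma - 1) = Rpower L sigma).
  { rewrite <- (Rpower_1 L) at 1 by lra. rewrite <- Rpower_plus. f_equal. ring. }
  assert (Hde : 0 < delta <= 1) by (unfold delta; nra).
  assert (Gr : forall u v, x0 <= u <= v -> F / 8 * (v - u) <= d v ^ 2 - d u ^ 2).
  { intros u v Huv. replace (F / 8) with (2 * (F / 16)) by field.
    apply (sqr_growth d d' x0); auto. intros x Hx. split; apply Hreg; auto. }
  assert (dp : forall x, x0 <= x -> 0 < d x) by (intros; now apply Hreg).
  assert (dinc : forall u v, x0 <= u <= v -> d u <= d v).
  { intros u v Huv. generalize (Gr u v Huv) (dp u ltac:(lra)) (dp v ltac:(lra)). intros.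
    assert (0 <= F / 8 * (v - u)) by (apply Rmult_le_pos; lra). nra. }
  assert (gap : forall u v, x0 <= u -> u + Cc * Rpower L sigma <= v ->
      d v <= PI * (L + 1) -> d u + delta <= d v).
  { intros u v Hu Huv Hv.
    generalize (Gr u v ltac:(lra)) (dinc u v ltac:(lra)) (dp u ltac:(lra)). intros G1 G2 G3.
    assert (PI * (L + 1) <= 8 * L) by nra.
    assert (d v + d u <= 16 * L) by lra.
    assert (F1 / 8 * (C1 * Rpower L sigma) <= F / 8 * (v - u)).
    { assert (0 < C1 * Rpower L sigma <= Cc * Rpower L sigma) by (split; nra).
      apply Rmult_le_compat; lra. }
    assert ((d v - d u) * (d v + d u) <= (d v - d u) * (16 * L))
      by (apply Rmult_le_compat_l; lra).
    assert (delta * (16 * L) <= (d v - d u) * (16 * L)).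
    { unfold delta. replace (c0 * Rpower L (sigma - 1) * (16 * L)) with
        (c0 * (16 * Rpower L sigma)) by (rewrite <- Els; ring).
      assert (c0 * (16 * Rpower L sigma) <= F1 * C1 / 128 * (16 * Rpower L sigma))
        by (apply Rmult_le_compat_r; lra).
      replace (F1 * C1 / 128 * (16 * Rpower L sigma)) with
        (F1 / 8 * (C1 * Rpower L sigma)) in * by field.
      replace ((d v - d u) * (d v + d u)) with (d v ^ 2 - d u ^ 2) in * by ring. lra. }
    assert (delta <= d v - d u) by (apply Rmult_le_reg_r with (16 * L); lra). lra. }
  assert (da : PI * L + delta <= d a).
  { rewrite <- dXl. apply gap; try lra. rewrite <- dXl1. apply dinc. lra. }
  assert (db : d b <= PI * (L + 1) - delta).
  { assert (d b + delta <= d Xl1) by (apply gap; lra). lra. }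
  (* Across the block [d ^ 2] gains PI^2 (2 L + 1) <= 48 L at rate at least F1 / 8, and 384 = 8 *
     48. *)
  assert (Xle : Xl1 - Xl <= 384 / F1 * L).
  { generalize (Gr Xl Xl1 ltac:(lra)). rewrite dXl, dXl1. intros G1.
    assert (F1 / 8 * (Xl1 - Xl) <= F / 8 * (Xl1 - Xl)) by (apply Rmult_le_compat_r; lra).
    assert ((PI * (L + 1)) ^ 2 - (PI * L) ^ 2 <= 48 * L).
    { replace ((PI * (L + 1)) ^ 2 - (PI * L) ^ 2) with (PI * PI * (2 * L + 1)) by ring.
      assert (PI * PI <= 16) by nra. nra. }
    apply Rmult_le_reg_l with (F1 / 8). lra.
    replace (F1 / 8 * (384 / F1 * L)) with (48 * L) by (field; lra). lra. }
  destruct (sum_range_csum a b (fun n => Cmult (RtoC (/ Rpower (d (INR n)) alpha)%R)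
          (expi (2 * gam (INR n) + h n))) ltac:(lra) Hab) as [m [N [-> HN]]].
  assert (HNx : forall n, (m <= n < m + N)%nat -> x0 <= a /\ a <= INR n <= b).
  { intros n Hn. specialize (HN n Hn). lra. }
  assert (BN : INR N <= (384 / F1 + 1) * L).
  { destruct N as [|N].
    - simpl. apply Rmult_le_pos. 2: lra. assert (0 < 384 / F1) by (apply Rdiv_lt_0_compat; lra). lra.
    - generalize (HN m ltac:(lia)) (HN (m + N)%nat ltac:(lia)). rewrite plus_INR, S_INR. lra. }
  set (T := Rpower L (- alpha)).
  (* Integers in the block are at least [L * L / Rmax 1 F2], because gam' is at least [3 * L] there
     and its square at most [8 * F * n]. [D] bounds the power [beta] of the denominator for all
     admissible [beta]. *)
  set (D := Rpower (Rmax 1 F2) B2).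
  set (eta := C2 * D * Rpower L (- (2 * beta))).
  assert (Dp : 0 < D) by apply exp_pos.
  assert (Heta : 0 <= eta).
  { unfold eta. apply Rmult_le_pos. nra. apply Rlt_le, exp_pos. }
  (* Half an increment of [2 * gam] is a value of gam', so [psi] inherits its bounds and
     monotonicity. The poles of the cotangent sit exactly at the values of gam' at the two ends [Xl]
     and [Xl1]. *)
  assert (slope : forall n, (m <= n)%nat -> (S n < m + N)%nat -> exists z,
     INR n <= z <= INR (S n) /\ (2 * gam (INR (S n)) - 2 * gam (INR n)) / 2 = d z).
  { intros n Hn HSn.
    generalize (HNx n ltac:(lia)) (HNx (S n) ltac:(lia)). rewrite S_INR. intros H1 H2.
    destruct (MVT_cor2 gam d (INR n) (INR n + 1)) as [z [Ez Hz]]. lra.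
    - intros z Hz. apply is_derive_Reals, Hreg. lra.
    - exists z. split. lra.
      replace (INR n + 1 - INR n) with 1 in Ez by ring. lra. }
  eapply Rle_trans.
  - apply (kuzmin_landau (fun n => 2 * gam (INR n)) h (fun n => / Rpower (d (INR n)) alpha)
      m N l delta T eta); auto.
    + apply Rlt_le, exp_pos.
    + intros n Hn HSn. destruct (slope n Hn HSn) as [z [Hz ->]].
      generalize (HNx n ltac:(lia)) (HNx (S n) ltac:(lia)). intros H1 H2.
      rewrite S_INR. fold L.
      generalize (dinc a z ltac:(lra)) (dinc z b ltac:(lra)). lra.
    + intros n Hn HSn. destruct (slope n Hn ltac:(lia)) as [z [Hz ->]].
      destruct (slope (S n) ltac:(lia) HSn) as [z' [Hz' ->]].
      generalize (HNx n ltac:(lia)). intros H1. apply dinc. lra.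
    + intros n Hn. cbv beta. rewrite <- Rpower_Ropp. split. apply Rlt_le, exp_pos.
      generalize (HNx n Hn). intros H1.
      apply Rpower_opp_le; auto. generalize (dinc a (INR n) ltac:(lra)). nra.
    + intros n Hn HSn. cbv beta. rewrite <- !Rpower_Ropp.
      generalize (HNx n ltac:(lia)) (HNx (S n) ltac:(lia)). intros H1 H2.
      apply Rpower_opp_le; auto. split. apply dp; lra. apply dinc.
      rewrite S_INR in *. lra.
    + intros n Hn HSn. generalize (HNx n ltac:(lia)). intros H1.
      eapply Rle_trans. apply Hh. lra.
      unfold eta. rewrite Rmult_assoc. apply Rmult_le_compat; try lra.
      apply Rlt_le, exp_pos.
      assert (n0 : 0 < INR n) by lra.
      set (F2' := Rmax 1 F2) in *.
      assert (F2p : 1 <= F2') by apply Rmax_l.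
      assert (F2q : F2 <= F2') by apply Rmax_r.
      assert (yn : L * L / F2' <= INR n).
      { destruct (Hreg (INR n) ltac:(lra)) as [_ [_ [_ [_ Hd]]]].
        assert (3 * L <= d (INR n)) by (generalize (dinc a (INR n) ltac:(lra)); nra).
        assert (9 * (L * L) <= d (INR n) ^ 2) by nra.
        assert (8 * F * INR n <= 8 * F2' * INR n) by (apply Rmult_le_compat_r; lra).
        apply Rmult_le_reg_r with F2'. lra.
        replace (L * L / F2' * F2') with (L * L) by (field; lra). nra. }
      assert (y0 : 0 < L * L / F2') by (apply Rdiv_lt_0_compat; nra).
      eapply Rle_trans. apply (Rpower_opp_le (L * L / F2')); lra.
      unfold D, Rpower. rewrite <- exp_plus.
      assert (LL : 0 < L * L) by (apply Rmult_lt_0_compat; lra).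
      assert (iF : 0 < / F2') by (apply Rinv_0_lt_compat; lra).
      assert (Eln : ln (L * L / F2') = ln L + ln L + - ln F2').
      { unfold Rdiv. rewrite ln_mult, ln_mult, ln_Rinv; lra. }
      rewrite Eln.
      assert (0 <= ln F2').
      { destruct (Req_dec F2' 1) as [->|]. rewrite ln_1; lra.
        rewrite <- ln_1. apply Rlt_le, ln_increasing; lra. }
      assert (Hle : - beta * (ln L + ln L + - ln F2') <= B2 * ln F2' + - (2 * beta) * ln L) by nra.
      destruct Hle as [Hlt|Heq]. apply Rlt_le, exp_increasing; auto. rewrite Heq; lra.
  - fold D. set (K := C2 * D * (384 / F1 + 1)).
    assert (EN : eta * INR N <= K * Rpower L (1 - 2 * beta)).
    { apply Rle_trans with (eta * ((384 / F1 + 1) * L)).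
      apply Rmult_le_compat_l; auto.
      unfold eta, K. replace (1 - 2 * beta) with (- (2 * beta) + 1) by ring.
      rewrite Rpower_plus, Rpower_1 by lra. right; ring. }
    assert (ET : T * (2 / delta) = 2 / c0 * Rpower L (- alpha - sigma + 1)).
    { unfold T, delta. replace (- alpha - sigma + 1) with (- alpha + - (sigma - 1)) by ring.
      rewrite Rpower_plus, (Rpower_Ropp L (sigma - 1)). field. lra. }
    rewrite ET.
    assert (K0 : 0 <= K).
    { unfold K. assert (0 < 384 / F1) by (apply Rdiv_lt_0_compat; lra).
      apply Rmult_le_pos; nra. }
    assert (P1 : 0 < Rpower L (1 - 2 * beta)) by apply exp_pos.
    rewrite !Rmult_assoc. apply Rmult_le_compat_l.
    apply Rlt_le, Rdiv_lt_0_compat; lra.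
    replace ((5 + K) * (Rpower L (- alpha - sigma + 1) * (1 + Rpower L (1 - 2 * beta))))
      with (Rpower L (- alpha - sigma + 1) * ((5 + K) * (1 + Rpower L (1 - 2 * beta)))) by ring.
    apply Rmult_le_compat_l. apply Rlt_le, exp_pos. nra.
Qed.

Theorem theorem5p2 :
  (* compact parameter set, contained in a box inside the domain *)
  forall (F1 F2 E1 E2 A1 B1 B2 C1 C2 : R),
    0 < F1 -> 0 < B1 -> 0 < C1 ->
  exists M : R, 0 < M /\
  forall (F E alpha beta sigma Cc : R),
    F1 <= F <= F2 -> E1 <= E <= E2 -> 0 <= alpha <= A1 ->
    B1 <= beta <= B2 -> 1/2 <= sigma <= 1 -> C1 <= Cc <= C2 ->
  forall (gam : R -> R) (X : nat -> R),
    is_phase F E gam -> is_X_seq gam X ->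
  exists L : nat, forall l : nat, (L <= l)%nat ->
  forall h : nat -> R,
    (forall n : nat, X l <= INR n <= X (S l) ->
       Rabs (h (S n) - h n) <= Cc * Rpower (INR n) (- beta)) ->
  forall a b : R,
    X l + Cc * Rpower (INR l) sigma <= a -> a < b ->
    b <= X (S l) - Cc * Rpower (INR l) sigma ->
    Cmod (sum_range a b (summand gam h alpha))
      <= M * (Rpower (INR l) (- alpha - sigma + 1)
              * (1 + Rpower (INR l) (1 - 2 * beta))).
Proof.
  intros F1 F2 E1 E2 A1 B1 B2 C1 C2 HF1 HB1 HC1.
  (* An empty parameter box may have [C2 <= 0]; [Rmax 1 C2] keeps the constant positive there
     too. *)
  exists (2 / Rmin 1 (F1 * C1 / 128) *
     (5 + Rmax 1 C2 * Rpower (Rmax 1 F2) B2 * (384 / F1 + 1))).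
  split.
  { apply Rmult_lt_0_compat. apply Rdiv_lt_0_compat. lra. apply Rmin_pos; nra.
    assert (0 < 384 / F1) by (apply Rdiv_lt_0_compat; lra).
    generalize (Rmax_l 1 C2) (exp_pos (B2 * ln (Rmax 1 F2))). fold (Rpower (Rmax 1 F2) B2).
    intros. assert (0 < Rmax 1 C2 * Rpower (Rmax 1 F2) B2) by (apply Rmult_lt_0_compat; lra).
    nra. }
  intros F E alpha beta sigma Cc HF _ Hal Hbe Hsi HCc gam X Hph [[L0 HL0] HX].
  destruct (phase_regularity F E gam ltac:(lra) Hph) as [x0 [Hx0 [gam2 Hreg]]].
  apply is_lim_seq_spec in HX. destruct (HX x0) as [L2 HL2].
  (* [L0] yields gam'(X l) = PI l, [L2] places [X l] and [X (S l)] beyond [x0], and 1 gives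
     [1 <= INR l]. Only this threshold depends on the phase. *)
  exists (max 1 (max L0 L2)). intros l Hl h Hh a b Ha Hab Hb.
  unfold sum_range.
  rewrite (map_ext (summand gam h alpha) (fun n => Cmult (RtoC (/ Rpower (Derive gam (INR n)) alpha)%R)
          (expi (2 * gam (INR n) + h n)))).
  2: { intros n. unfold summand, expi, Cmult, RtoC; simpl. f_equal; ring. }
  apply (phase_sum_bound F1 F2 B2 C1 (Rmax 1 C2) F alpha beta sigma Cc x0 (X l) (X (S l)) a b
     gam (Derive gam) gam2 h l); auto; try lra; try lia.
  - generalize (Rmax_r 1 C2). lra.
  - apply Rlt_le, HL2. lia.
  - apply Rlt_le, HL2. lia.
  - apply HL0. lia.
  - apply HL0. lia.
Qed.
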